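(* Let $p\ge 2$ and $s\ge 1$ be fixed integers. Then there exists $n_0=n_0(p,s)$ such that for every integer $n\ge n_0$ the following holds. If $G$ is an $n$-vertex graph that is not $p$-partite and satisfies $e(G)\ge e(Y_{n,p,s})$, then $$\#K_{p+1}(G)\ \ge\ \#K_{p+1}(Y_{n,p,s}).$$ Moreover, the bound is sharp and is attained by $Y_{n,p,s}$: the graph $Y_{n,p,s}$ is itself an $n$-vertex graph that is not $p$-partite, it satisfies the edge condition, and equality holds for $G=Y_{n,p,s}$.
   Context: All graphs are finite and simple. For a graph $G$, $e(G)$ denotes its number of edges and $\#K_{p+1}(G)$ denotes the number of copies of the complete graph $K_{p+1}$ in $G$ (i.e. the number of $(p+1)$-element vertex subsets that induce a clique). A graph is $p$-partite if its vertex set can be partitioned into $p$ (possibly empty) independent sets, i.e. its chromatic number is at most $p$. The Turán graph $T_{n,p}$ is the complete $p$-partite graph on $n$ vertices with the maximum number of edges; equivalently, its part sizes differ pairwise by at most one. Definition of $Y_{n,p,s}$. Let $p,n,s$ be integers with $n\ge 2p\ge 4$ and $1\le s\le \lfloor n/p\rfloor$. Let $T_1,\dots,T_p$ be the parts of $T_{n,p}$, ordered so that $|T_1|\ge |T_2|\ge\cdots\ge |T_p|$. Choose two distinct vertices $u^*,v_1\in T_1$, choose $X_1\subseteq T_p$ with $|X_1|=s$, and set $X_2=T_p\setminus X_1$. Then $Y_{n,p,s}$ is the graph obtained from $T_{n,p}$ by adding the edge $u^*v_1$ and deleting all edges between $u^*$ and $X_2$. (It is well defined up to isomorphism.) One has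 $e(Y_{n,p,s})=e(T_{n,p})-\lfloor n/p\rfloor+s+1$, and $\#K_{p+1}(Y_{n,p,s})=s\prod_{i=2}^{p-1}|T_i|$, where the empty product (case $p=2$) equals $1$. *)

(* Defs.v *)
From mathcomp Require Import all_boot.

Set Implicit Arguments.
Unset Strict Implicit.
Unset Printing Implicit Defensive.

Record sgraph (V : finType) := SGraph {
  adj :> rel V;
  adj_sym : symmetric adj;
  adj_irr : irreflexive adj }.

Section Graphs.
Variable V : finType.
Implicit Type G : sgraph V.

Definition num_edges G : nat :=
  #|[set A : {set V} | [exists x, exists y, G x y && (A == [set x; y])]]|.

Definition is_clique G (A : {set V}) : bool :=
  [forall x in A, forall y in A, (x != y) ==> G x y].

Definition num_cliques (k : nat) G : nat :=
  #|[set A : {set V} | (#|A| == k) && is_clique G A]|.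

(* The colour classes are the independent sets; some may be empty. *)
Definition partite (p : nat) G : Prop :=
  exists c : V -> 'I_p, forall x y, G x y -> c x != c y.

Section Multipartite.
Variables (p : nat) (c : V -> 'I_p).

Definition multipartite_rel : rel V := fun x y => c x != c y.

Lemma multipartite_sym : symmetric multipartite_rel.
Proof. by move=> x y; rewrite /multipartite_rel eq_sym. Qed.

Lemma multipartite_irr : irreflexive multipartite_rel.
Proof. by move=> x; rewrite /multipartite_rel eqxx. Qed.

Definition complete_multipartite : sgraph V :=
  SGraph multipartite_sym multipartite_irr.

(* Parts are numbered from 0: T_1, ..., T_p are part 0, ..., part p.-1. *)
Definition part (i : nat) : {set V} := [set x | val (c x) == i].

End Multipartite.

(* The complete p-partite graph of c is a Turan graph T_{#|V|,p}. *)
Definition turan_partition (p : nat) (c : V -> 'I_p) : Prop :=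
  forall c' : V -> 'I_p,
    num_edges (complete_multipartite c') <= num_edges (complete_multipartite c).

(* Add the edge uv to the complete multipartite graph of c, and delete all
   edges between u and X2. *)
Definition Y_rel (p : nat) (c : V -> 'I_p) (u v : V) (X2 : {set V}) : rel V :=
  fun x y =>
    ([set x; y] == [set u; v]) ||
    [&& complete_multipartite c x y,
        ~~ ((x == u) && (y \in X2)) & ~~ ((y == u) && (x \in X2))].

(* Y is a copy of Y_{n,p,s}: the graph is only defined up to isomorphism, so
   every admissible choice of the parts, of u, v and of X1 is allowed. *)
Definition is_Y (n p s : nat) (Y : sgraph V) : Prop :=
  [/\ 4 <= 2 * p, 2 * p <= n, 1 <= s, s <= n %/ p & #|V| = n] /\
  exists (c : V -> 'I_p) (u v : V) (X1 : {set V}),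
    [/\ turan_partition c,
        forall i j, i <= j < p -> #|part c j| <= #|part c i|,
        [/\ u \in part c 0, v \in part c 0 & u != v],
        X1 \subset part c p.-1 /\ #|X1| = s
      & forall x y, Y x y = Y_rel c u v (part c p.-1 :\: X1) x y].

End Graphs.

(* Main.v *)
Require Import Defs.
From mathcomp Require Import all_boot zify.

(* Suppose G has fewer copies of K_{p+1} than Y; then it has O(n^(p-2)) of them.
   An extremal choice of a vertex set U discards few vertices and leaves minimum
   degree about (1 - 1/p)n, so U contains a positive proportion of all possible
   p-cliques.  Counting shows that one of these p-cliques, Q, meets no K_{p+1} in
   p - 1 or more vertices; classifying vertices by the unique vertex of Q they
   miss gives a p-colouring with o(n^2) monochromatic edges.  For a colouring with
   the least number of monochromatic edges, each such edge uv must have almost no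
   common neighbour in some other class (otherwise it lies in too many K_{p+1}),
   which costs about n/p missing edges; as G has only n/p + O(1) edges less than
   the Turan graph, all monochromatic edges share one vertex u.  If u has k
   neighbours in its own class and q in the class where it misses most, the edge
   count forces at least kq - (k + q - s - 1) >= s edges between these two
   neighbourhoods, each extending to about (n/p)^(p-2) copies of K_{p+1}
   through u; exactly s such edges occur only if all other pairs are adjacent and
   the class sizes are almost equal, which yields the exact bound. *)

Set Implicit Arguments.
Unset Strict Implicit.
Unset Printing Implicit Defensive.

(** * Counting cliques *)

Section Cliques.
Variables (V : finType) (G : sgraph V).
Implicit Types (x y u v : V) (A B C D S : {set V}).

Definition nb x := [set y | G x y].

Definition cliques m C : {set {set V}} :=
  [set A : {set V} | [&& #|A| == m, is_clique G A & A \subset C]].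

Definition clq m C := #|cliques m C|.

Lemma adjC x y : G x y = G y x.
Proof. exact: adj_sym. Qed.

Lemma adj_neq x y : G x y -> x != y.
Proof. by apply: contraTneq => ->; rewrite adj_irr. Qed.

Lemma is_cliqueP A :
  reflect {in A &, forall x y, x != y -> G x y} (is_clique G A).
Proof.
apply: (iffP forall_inP) => [h x y hx hy nxy | h x hx].
  by have /forall_inP/(_ y hy)/implyP/(_ nxy) := h x hx.
by apply/forall_inP => y hy; apply/implyP; apply: h.
Qed.

Lemma is_clique_sub A B : B \subset A -> is_clique G A -> is_clique G B.
Proof.
move=> /subsetP sBA /is_cliqueP h; apply/is_cliqueP => x y /sBA hx /sBA hy.
exact: h.
Qed.

Lemma is_cliqueU1 x A : is_clique G A -> A \subset nb x -> is_clique G (x |: A).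
Proof.
move=> /is_cliqueP h /subsetP hx; apply/is_cliqueP => y z.
rewrite !in_setU1 => /orP[/eqP->|hy] /orP[/eqP->|hz].
- by rewrite eqxx.
- by move=> _; have := hx z hz; rewrite inE.
- by move=> _; have := hx y hy; rewrite inE adjC.
exact: h.
Qed.

Lemma num_cliquesE m : num_cliques m G = clq m setT.
Proof. by apply: eq_card => A; rewrite !inE subsetT andbT. Qed.

Lemma clq_sub m C D : C \subset D -> clq m C <= clq m D.
Proof.
move=> sCD; apply/subset_leq_card/subsetP => A; rewrite !inE.
by case/and3P => -> -> /subset_trans ->.
Qed.

Lemma clq_gt0_0 C : 0 < clq 0 C.
Proof.
apply/card_gt0P; exists set0; rewrite inE cards0 sub0set eqxx andbT /=.
by apply/is_cliqueP => x y; rewrite inE.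
Qed.

(** Adding [x] to cliques inside its neighbourhood is injective. [D] and [C] are kept apart because
    both [D = C] and [D] disjoint from [C] are used below. *)
Lemma clq_link m C D x : x \in D -> 
  clq m (C :&: nb x) <=
  #|[set S in cliques m.+1 (D :|: C) | (x \in S) && (S :\ x \subset C)]|.
Proof.
move=> xD; have xN A : A \in cliques m (C :&: nb x) -> x \notin A.
  rewrite inE => /and3P[_ _ /subsetP sA]; apply/negP => /sA.
  by rewrite !inE adj_irr andbF.
rewrite /clq -(card_in_imset (f := fun A => x |: A)).
  apply/subset_leq_card/subsetP => _ /imsetP[A hA ->].
  have nA := xN A hA; move: hA; rewrite !inE => /and3P[/eqP cA qA].
  rewrite subsetI => /andP[sC sN].
  rewrite cardsU1 nA cA add1n eqxx eqxx setU1K // sC is_cliqueU1 //= andbT.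
  by apply/subsetP => y; rewrite !inE => /orP[/eqP->|/(subsetP sC)->];
     rewrite ?xD ?orbT.
by move=> A B hA hB e; rewrite -(setU1K (xN A hA)) e setU1K ?xN.
Qed.

Lemma sum_link m C D :
  \sum_(x in D) clq m (C :&: nb x) <=
  \sum_(S in cliques m.+1 (D :|: C)) #|[set x in D | (x \in S) && (S :\ x \subset C)]|.
Proof.
apply: (@leq_trans (\sum_(x in D) \sum_(S in cliques m.+1 (D :|: C))
   ((x \in S) && (S :\ x \subset C)))).
  apply: leq_sum => x xD; apply: leq_trans (clq_link _ _ xD) _.
  rewrite -sum1_card big_mkcond [X in _ <= X]big_mkcond /=.
  by apply: leq_sum => S _; rewrite inE; case: (S \in _) => //=; case: (_ && _).
rewrite exchange_big /=; apply: leq_sum => S _.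
rewrite -sum1_card big_mkcond [X in _ <= X]big_mkcond /=.
by apply: leq_sum => x _; rewrite inE; case: (x \in D) => //=; case: (_ && _).
Qed.

(** With [D = C], a clique is reached at most once from each of its [m.+1] vertices. *)
Lemma sum_clq m C : \sum_(x in C) clq m (C :&: nb x) <= m.+1 * clq m.+1 C.
Proof.
apply: leq_trans (sum_link _ _ _) _; rewrite setUid mulnC -sum_nat_const.
apply: leq_sum => S; rewrite inE => /and3P[/eqP <- _ _].
by apply/subset_leq_card/subsetP => x; rewrite inE => /and3P[].
Qed.

(** Here a clique is reached at most once: all its vertices but the chosen one lie in [C], which
    excludes a second choice in [D]. *)
Lemma sum_clq_disjoint m C D : [disjoint D & C] ->
  \sum_(x in D) clq m (C :&: nb x) <= clq m.+1 (D :|: C).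
Proof.
move=> dDC; apply: leq_trans (sum_link _ _ _) _.
rewrite /clq -sum1_card; apply: leq_sum => S _.
apply/card_le1_eqP => x y; rewrite !inE => /and3P[xD xS /subsetP sx].
move=> /and3P[yD yS _]; apply/eqP; apply: contraTT (yD) => nxy.
have /sx yC : y \in S :\ x by rewrite !inE yS nxy.
by rewrite (disjointFl dDC yC).
Qed.

Lemma clq_nb m x : clq m (nb x) <= clq m.+1 setT.
Proof.
have := @sum_clq_disjoint m (~: [set x]) [set x].
rewrite big_set1 setUCr; have -> : ~: [set x] :&: nb x = nb x.
  by apply/setIidPr/subsetP => y; rewrite !inE eq_sym => /adj_neq.
by apply; rewrite -setI_eq0 setICr.
Qed.

Lemma clq_nb2 m x y : G x y -> clq m (nb x :&: nb y) <= clq m.+2 setT.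
Proof.
move=> gxy; apply: leq_trans (clq_nb _ x).
have := @sum_clq_disjoint m (nb x :\ y) [set y].
rewrite big_set1 setD1K ?inE //; have -> : (nb x :\ y) :&: nb y = nb x :&: nb y.
  apply/setP => z; rewrite !inE; case: eqP => [->|//].
  by rewrite !adj_irr ?andbF.
by apply; rewrite disjoints1 !inE eqxx.
Qed.

(** Vertices are picked one by one. Each pick costs at most [b] candidates, so every pick has at
    least [L] choices; the factorial accounts for the orders. The size condition is guarded by
    [0 < m] because nothing is known about the candidates left after the last pick. *)
Lemma greedy_cliques m L b C : {in C, forall x, #|C :\: nb x| <= b} ->
  (0 < m -> L + m.-1 * b <= #|C|) -> L ^ m <= m`! * clq m C.
Proof.
elim: m C => [|m IH] C hC hL; first by rewrite mul1n clq_gt0_0.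
rewrite factS mulnAC; apply: (@leq_trans (\sum_(x in C) clq m (C :&: nb x) * m`!)).
  rewrite expnS (@leq_trans (#|C| * L ^ m)) //.
    by rewrite leq_mul2r (leq_trans _ (hL isT)) ?leq_addr ?orbT.
  rewrite -sum_nat_const leq_sum // => x xC; rewrite mulnC IH //.
    by move=> y; rewrite inE => /andP[yC _]; rewrite (leq_trans _ (hC y yC)) //
      subset_leq_card // setSD // subsetIl.
  move=> m0; have := hL isT; have := hC x xC; rewrite /= -(cardsID (nb x) C).
  case: (m) m0 => //= k _; rewrite mulSn; lia.
by rewrite -big_distrl /= leq_mul2r sum_clq orbT.
Qed.

(** The same greedy choice with one vertex per class: the classes are disjoint and taken in a fixed
    order, so no factorial appears. *)
Lemma greedy_transversal (I : finType) (c : V -> I) (s : seq I)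
    (D : I -> {set V}) b : uniq s ->
  (forall i x, i \in s -> x \in D i -> c x = i) ->
  (forall i j x, i \in s -> j \in s -> i != j -> x \in D i ->
     #|D j :\: nb x| <= b) ->
  \prod_(i <- s) (#|D i| - size s * b) <= clq (size s) (\bigcup_(i <- s) D i).
Proof.
elim: s D => [|i s IH] D /=; first by rewrite big_nil clq_gt0_0.
case/andP=> nis us hc hb; rewrite !big_cons.
apply: (@leq_trans (\sum_(x in D i) clq (size s) ((\bigcup_(j <- s) D j) :&: nb x))).
  apply: (@leq_trans (#|D i| * \prod_(j <- s) (#|D j| - (size s).+1 * b))).
    by rewrite leq_mul2r leq_subr orbT.
  rewrite -sum_nat_const leq_sum // => x xD; rewrite big_distrl /=.
  (* Passing to the neighbourhood of [x] uses up one of the [(size s).+1] copies of [b]. *)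
  apply: (@leq_trans (\prod_(j <- s) (#|D j :&: nb x| - size s * b))).
    rewrite big_seq [X in _ <= X]big_seq; apply: leq_prod => j js.
    have := hb i j x (mem_head _ _); rewrite inE js orbT => /(_ isT).
    have -> : i != j by apply: contraNneq nis => ->.
    move=> /(_ isT xD); rewrite -(cardsID (nb x) (D j)); lia.
  apply: IH => // [j y js|j k y js ks njk].
    by rewrite inE => /andP[yD _]; apply: hc; rewrite // inE js orbT.
  rewrite inE => /andP[yD _]; rewrite (leq_trans _ (hb j k y _ _ _ yD)) ?inE ?js ?ks ?orbT //.
  by rewrite subset_leq_card // setSD // subsetIl.
apply: sum_clq_disjoint; apply/pred0P => x /=; apply/negP => /andP[xD].
rewrite bigcup_seq => /bigcupP[j js xDj]; move: nis.
rewrite -(hc i x) ?mem_head // (hc j x) ?js // inE js ?orbT //.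
Qed.

Lemma clq_gt0_nonpartite p : 0 < clq p.+1 setT -> ~ partite p G.
Proof.
case/card_gt0P => A; rewrite inE subsetT andbT => /andP[/eqP cA /is_cliqueP qA] [c hc].
have : #|c @: A| <= p by rewrite -[X in _ <= X](card_ord p) max_card.
rewrite card_in_imset ?cA ?ltnn // => x y xA yA e; apply/eqP/negPn/negP => nxy.
by have /eqP := hc x y (qA x y xA yA nxy); rewrite e.
Qed.

End Cliques.

(** * Degree sum formula *)

Section DoubleCount.
Variables (V : finType) (G : sgraph V).

Lemma cards2_inj (x y z w : V) : x != y -> [set z; w] = [set x; y] ->
  (z, w) = (x, y) \/ (z, w) = (y, x).
Proof.
move=> nxy e; have := set21 z w; have := set22 z w; rewrite e.
have := set21 x y; have := set22 x y; rewrite -e.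
rewrite !in_set2 => /orP[]/eqP h1 /orP[]/eqP h2 /orP[]/eqP h3 /orP[]/eqP h4; subst;
  by [left|right|rewrite eqxx in nxy].
Qed.

Lemma num_edges2 : (num_edges G).*2 = \sum_x #|nb G x|.
Proof.
rewrite -muln2 /num_edges -sum_nat_const.
transitivity (\sum_(A in [set A : {set V} | [exists x, exists y, G x y && (A == [set x; y])]])
  \sum_x \sum_y (G x y && (A == [set x; y]) : nat)).
  apply: eq_bigr => A; rewrite inE => /existsP[x /existsP[y /andP[gxy /eqP ->]]].
  have nxy := adj_neq gxy.
  rewrite pair_big /= (bigD1 (x, y)) //= (bigD1 (y, x)) /=; last first.
    by apply: contraNneq nxy => -[->].
  rewrite eqxx gxy [G y x]adjC gxy setUC eqxx big1 //= => -[z w] /= /andP[n1 n2].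
  case: eqP => [e|]; last by rewrite andbF.
  have /(cards2_inj nxy) : [set z; w] = [set x; y] by rewrite -e setUC.
  by case=> e'; rewrite e' eqxx in n1 n2.
rewrite exchange_big /=; apply: eq_bigr => x _; rewrite exchange_big /=.
rewrite -sum1_card [RHS]big_mkcond /=; apply: eq_bigr => y _; rewrite inE.
case gxy: (G x y) => /=; last by rewrite big1.
rewrite (bigD1 [set x; y]) /=; last first.
  by rewrite inE; apply/existsP; exists x; apply/existsP; exists y; rewrite gxy eqxx.
by rewrite eqxx big1 ?addn0 // => A /andP[_ /negbTE ->].
Qed.

End DoubleCount.

(** * Stability *)

Section Stability.
Variables (V : finType) (G : sgraph V).
Implicit Types (x y u v : V) (A B C D S Q U : {set V}).

(** Ordered pairs, diagonal included: [#|U| ^ 2] minus twice the number of edges inside [U]. *)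
Definition nonedges2 U := \sum_(x in U) #|U :\: nb G x|.

Lemma card_setD_nb U x : #|U :\: nb G x| = \sum_(y in U) ~~ G x y.
Proof.
rewrite -sum1_card big_mkcond [RHS]big_mkcond; apply: eq_bigr => y _.
by rewrite !inE; case: (y \in U); case: (G x y).
Qed.

(** The pair [(u, u)] is lost once but counted twice on the right, hence the successor. *)
Lemma nonedges2D1 U u : u \in U ->
  (nonedges2 U).+1 = nonedges2 (U :\ u) + 2 * #|U :\: nb G u|.
Proof.
move=> uU; rewrite /nonedges2 (big_setD1 u uU) /=.
under eq_bigr do rewrite card_setD_nb (big_setD1 u uU) /=.
rewrite big_split /=; under [\sum_(i in U :\ u) \sum_(j in _) _]eq_bigr do rewrite -card_setD_nb.
have -> : \sum_(i in U :\ u) (~~ G i u : nat) = (#|U :\: nb G u|).-1.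
  rewrite card_setD_nb (big_setD1 u uU) /= adj_irr /=.
  by apply: eq_bigr => i _; rewrite adjC.
have : 0 < #|U :\: nb G u| by apply/card_gt0P; exists u; rewrite !inE adj_irr uU.
lia.
Qed.

(* An extremal choice replaces the usual iterated deletion of vertices of small degree. *)
Lemma min_degree_subset C a b : exists U,
  [/\ U \subset C,
      b * nonedges2 U + a * #|C| ^ 2 <= b * nonedges2 C + a * #|U| ^ 2
    & forall u, u \in U -> 2 * b * #|U :\: nb G u| <= 2 * a * #|U| + b].
Proof.
(* [F] weighs non-edges against discarded vertices. At a minimiser, comparison with [U :\ u] bounds
   the number of non-neighbours of each [u]. *)
pose F U := b * nonedges2 U + a * (#|C| ^ 2 - #|U| ^ 2).
case: (@arg_minnP _ C (fun U => U \subset C) F (subxx C)) => U sUC minU; exists U.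
have le U' : U' \subset C -> #|U'| ^ 2 <= #|C| ^ 2.
  by move=> s; rewrite leq_exp2r // subset_leq_card.
split=> //.
  have := minU C (subxx C); rewrite /F subnn muln0 addn0 => h.
  have := le U sUC; nia.
move=> u uU; have sD : U :\ u \subset C by rewrite (subset_trans _ sUC) ?subD1set.
have := minU _ sD; have := nonedges2D1 uU; have := le U sUC.
rewrite /F (cardsD1 u U) uU /= add1n.
set k := #|U :\ u|; set e := nonedges2 U; set e' := nonedges2 (U :\ u).
set d := #|U :\: _|; set N := #|C| ^ 2 => le1 eq1 le2.
have e1 : b * e + b = b * e' + 2 * b * d by rewrite -mulnSr eq1; lia.
have : N - k ^ 2 = N - k.+1 ^ 2 + (2 * k + 1) by lia.
move=> e2; rewrite e2 mulnDr in le2; nia.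
Qed.

(** The hypothesis puts the edge density of [C] above [1 - 1/p]. The extremal subset [W] then has at
    least [n / J] vertices, and any [p] vertices of [W] leave about [#|W| / J] common neighbours, so
    the greedy choice of [p.+1] vertices has linearly many options at each step. *)
Lemma supersaturation p J C n : 0 < p -> 0 < J ->
  p * J * nonedges2 C + n ^ 2 <= J.-1 * #|C| ^ 2 ->
  exists2 L, 2 * n <= 2 * J ^ 2 * L + p * J ^ 2 & L ^ p.+1 <= p.+1`! * clq G p.+1 C.
Proof.
move=> p0 J0 hC; have [W [sWC hW dW]] := min_degree_subset C J.-1 (p * J).
have [b hb db] : exists2 b, b * (2 * (p * J)) <= 2 * J.-1 * #|W| + p * J
    & {in W, forall x, #|W :\: nb G x| <= b}.
  exists ((2 * J.-1 * #|W| + p * J) %/ (2 * (p * J))); first exact: leq_divM.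
  move=> x xW; rewrite leq_divRL; last by rewrite !muln_gt0 p0 J0.
  by rewrite mulnC dW.
have nW : n <= J * #|W|.
  rewrite -leq_sqr expnMn; have h : n ^ 2 <= J.-1 * #|W| ^ 2 by lia.
  apply: (leq_trans h); rewrite leq_mul2r; apply/orP; right.
  by rewrite (leq_trans (leq_pred _)) // leq_pmulr.
have hL : 2 * #|W| <= 2 * J * (#|W| - p * b) + p * J.
  case: J J0 hb {hC hW dW nW} => // j _ hb.
  have [le|/leq_mul h] := leqP (p * b) #|W|; last by have := h _ _ (leqnn j.+1); lia.
  have [d e] : exists d, #|W| = d + p * b by exists (#|W| - p * b); lia.
  by move: hb; rewrite /= e addnK; lia.
exists (#|W| - p * b).
  by have := leq_mul (leqnn J) hL; rewrite -mulnn; lia.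
apply: leq_trans (_ : p.+1`! * clq G p.+1 W <= _); last first.
  by rewrite leq_mul2l clq_sub ?orbT.
have [le|lt] := leqP (p * b) #|W|; last first.
  by rewrite (eqP (_ : #|W| - p * b == 0)) ?exp0n // subn_eq0 ltnW.
by apply: (greedy_cliques db) => _ /=; rewrite subnK.
Qed.

(** The threshold [p.-1] is the one the classes below need: an edge inside a class forms a [K_{p+1}]
    with [p.-1] vertices of [Q]. *)
Definition isolated_clique p Q :=
  forall S, S \in cliques G p.+1 setT -> #|S :&: Q| < p.-1.

(** A clique [Q] that is not isolated consists of a subset of some [K_{p+1}] and one further vertex
    [w], which leaves at most [2 ^ p.+1 * #|V|] possibilities for each [K_{p+1}]. *)
Lemma isolated_clique_exists p U : 0 < p ->
  clq G p.+1 setT * (2 ^ p.+1 * #|V|) < clq G p U ->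
  exists2 Q, Q \in cliques G p U & isolated_clique p Q.
Proof.
move=> p0; have [/exists_inP[Q hQ /forall_inP h] _|] :=
  boolP [exists Q in cliques G p U, [forall S in cliques G p.+1 setT, #|S :&: Q| < p.-1]].
  by exists Q.
rewrite negb_exists_in => /forall_inP bad; rewrite ltnNge => /negP[].
pose f (Aw : {set V} * V) := Aw.2 |: Aw.1.
pose F S := f @: setX (powerset S) [set: V].
apply: (@leq_trans #|\bigcup_(S in cliques G p.+1 setT) F S|).
  apply/subset_leq_card/subsetP => Q hQ.
  have := bad Q hQ; rewrite negb_forall_in => /exists_inP[S hS].
  rewrite -leqNgt => hSQ; apply/bigcupP; exists S => //.
  move: hQ; rewrite inE => /and3P[/eqP cQ _ _].
  (* At most one vertex of [Q] lies outside [S]; if none does, any vertex of [Q] serves as [w]. *)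
  have [w [wQ sw]] : exists w, w \in Q /\ Q :\: S \subset [set w].
    have : #|Q :\: S| <= 1 by have := cardsID S Q; rewrite setIC; lia.
    have [e _|ne] := eqVneq (Q :\: S) set0.
      have /card_gt0P[w wQ] : 0 < #|Q| by rewrite cQ.
      by exists w; rewrite e sub0set.
    have /set0Pn[w wQS] := ne => /card_le1_eqP h.
    exists w; split; first by move: wQS; rewrite inE => /andP[].
    by apply/subsetP => y hy; rewrite inE (h y w).
  apply/imsetP; exists (S :&: Q, w); first by rewrite !inE subsetIl.
  apply/setP => y; rewrite !inE; have := subsetP sw y; rewrite !inE.
  case: (eqVneq y w) => [->|_]; rewrite ?wQ //=.
  by case: (y \in S) => //=; case: (y \in Q) => // /(_ isT).
apply: (@leq_trans (\sum_(S in cliques G p.+1 setT) 2 ^ p.+1 * #|V|)); last first.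
  by rewrite sum_nat_const.
apply: (@leq_trans (\sum_(S in cliques G p.+1 setT) #|F S|)).
  elim/big_rec2: _ => [|S m A _ IH]; first by rewrite cards0.
  by rewrite cardsU (leq_trans (leq_subr _ _)) // leq_add2l.
apply: leq_sum => S; rewrite inE => /and3P[/eqP <- _ _].
by rewrite (leq_trans (leq_imset_card _ _)) // cardsX card_powerset cardsT.
Qed.

(** * Classes of vertices relative to an isolated clique *)

Section Classes.
Variables (p : nat) (Q U : {set V}).
Hypotheses (p2 : 2 <= p) (qQ : Q \in cliques G p setT) (isoQ : isolated_clique p Q).

Let cQ : #|Q| = p. Proof. by move: qQ; rewrite inE => /and3P[/eqP]. Qed.
Let cliqueQ : is_clique G Q. Proof. by move: qQ; rewrite inE => /and3P[]. Qed.

Definition cls x := [set v | Q :\ x \subset nb G v].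
Definition unclassed := [set v | [forall x in Q, v \notin cls x]].

(** An edge [v w] inside the class would complete [Q :\ x] to a [K_{p+1}] meeting [Q] in [p.-1]
    vertices. *)
Lemma cls_independent x v w : x \in Q -> v \in cls x -> w \in cls x -> ~~ G v w.
Proof.
rewrite !inE => xQ hv hw; apply/negP => gvw.
have cD : #|Q :\ x| = p.-1 by have := cardsD1 x Q; rewrite xQ cQ; lia.
have notin y : Q :\ x \subset nb G y -> y \notin Q :\ x.
  by move=> /subsetP h; apply/negP => /h; rewrite inE adj_irr.
have vw : v \notin w |: Q :\ x.
  by rewrite in_setU1 negb_or (adj_neq gvw) notin.
have := isoQ (S := v |: (w |: Q :\ x)); rewrite inE subsetT andbT.
rewrite cardsU1 vw cardsU1 notin // cD /=.
have -> : is_clique G (v |: (w |: Q :\ x)).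
  apply: is_cliqueU1; first by apply: is_cliqueU1 => //; apply: is_clique_sub cliqueQ; apply: subD1set.
  by rewrite subUset sub1set inE gvw.
have -> : (1 + (1 + p.-1) == p.+1) by lia.
move=> /(_ isT); rewrite ltnNge -cD subset_leq_card //.
by apply/subsetP => y hy; rewrite in_setI !in_setU1 hy !orbT /=; move: hy; rewrite inE => /andP[].
Qed.

Lemma missed_gt0 v : 0 < #|Q :\: nb G v|.
Proof.
rewrite lt0n cards_eq0 setD_eq0; apply/negP => sQ.
have vQ : v \notin Q by apply/negP => /(subsetP sQ); rewrite inE adj_irr.
have := isoQ (S := v |: Q); rewrite inE subsetT andbT cardsU1 vQ cQ /= add1n eqxx.
rewrite is_cliqueU1 // => /(_ isT); rewrite (setIidPr (subsetUr _ _)) cQ; lia.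
Qed.

Lemma missed_unclassed v : v \in unclassed -> 1 < #|Q :\: nb G v|.
Proof.
rewrite inE => /forall_inP hv; have := missed_gt0 v.
rewrite leq_eqVlt => /orP[|//]; rewrite eq_sym => /cards1P[x ex].
have xQ : x \in Q by have : x \in Q :\: nb G v; [rewrite ex inE | rewrite inE => /andP[]].
have := hv x xQ; rewrite inE => /negP[]; apply/subsetP => y /[!inE] /andP[nyx yQ].
apply: contraR nyx => ngy; have : y \in Q :\: nb G v by rewrite !inE ngy.
by rewrite ex inE.
Qed.

(** Every vertex misses some vertex of [Q], and an unclassed one misses at least two; so unclassed
    vertices show up as an excess of non-adjacencies to [Q]. *)
Lemma sum_missed : #|U| + #|U :&: unclassed| <= \sum_(x in Q) #|U :\: nb G x|.
Proof.
under eq_bigr do rewrite card_setD_nb.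
rewrite exchange_big /= -!sum1_card big_mkcond [X in _ + X <= _]big_mkcond /= -big_split /=.
rewrite [X in _ <= X]big_mkcond; apply: leq_sum => v _; rewrite inE.
case: (v \in U) => //=; under eq_bigr do rewrite adjC; rewrite -card_setD_nb.
by case: ifP => [/missed_unclassed|_]; [|rewrite addn0 missed_gt0].
Qed.

Lemma class_colouring : exists c : V -> 'I_p,
  forall v w, v \notin unclassed -> w \notin unclassed -> c v = c w -> ~~ G v w.
Proof.
have p0 : 0 < p by lia.
have /card_gt0P[x0 _] : 0 < #|Q| by rewrite cQ.
have colP v : v \notin unclassed -> {i : 'I_p | v \in cls (nth x0 (enum Q) i)}.
  move=> hv; apply: sigW; move: hv; rewrite inE negb_forall_in => /exists_inP[x xQ].
  rewrite negbK => vx; have hi : index x (enum Q) < p by rewrite -cQ cardE index_mem mem_enum.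
  by exists (Ordinal hi); rewrite nth_index ?mem_enum.
(* Unclassed vertices receive the default colour 0; nothing is claimed about them. *)
pose c v := if boolP (v \notin unclassed) is AltTrue h then sval (colP v h) else Ordinal p0.
exists c => v w hv hw; rewrite /c.
case: {-}_ / boolP => [h1|]; last by rewrite hv.
case: {-}_ / boolP => [h2|]; last by rewrite hw.
case: (colP v h1) => i vi; case: (colP w h2) => j wj /= e; rewrite -e in wj.
by apply: cls_independent vi wj; rewrite -mem_enum mem_nth // -cardE cQ.
Qed.

End Classes.

(** Twice the number of monochromatic edges. *)
Definition inner2 p (c : V -> 'I_p) := \sum_x #|[set y in nb G x | c y == c x]|.

Lemma inner2_cover p (c : V -> 'I_p) (R : {set V}) :
  (forall v w, v \notin R -> w \notin R -> c v = c w -> ~~ G v w) ->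
  inner2 c <= 2 * #|R| * #|V|.
Proof.
move=> hR; apply: (@leq_trans (\sum_(x : V) ((x \in R) * #|V| + #|R|))).
  apply: leq_sum => x _; case: (boolP (x \in R)) => xR.
    by rewrite mul1n (leq_trans (max_card _)) // leq_addr.
  apply/subset_leq_card/subsetP => y; rewrite !inE => /andP[gxy /eqP e].
  by apply: contraTT gxy => yR; apply: hR.
rewrite big_split /= -big_distrl /= sum_nat_const.
have -> : \sum_(x : V) (x \in R : nat) = #|R| by rewrite -sum1_card [RHS]big_mkcond.
by rewrite [X in _ + X]mulnC addnn -mul2n mulnA.
Qed.

End Stability.

(** With [b] about [(1 + 1/J) u / p], discarding [p.-1] times [b] vertices leaves about
    [(1 - (p - 1)/J) u / p], which is at least [u / (2 p)] because [2 * p <= J]. *)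
Lemma greedy_bound p J u b : 0 < p -> 0 < J -> 2 * p <= J -> p * p <= u ->
  b * (2 * (p * J)) <= 2 * J.+1 * u + p * J ->
  p.-1 * b <= u /\ u <= 2 * p * (u - p.-1 * b) + p.-1 * p.
Proof.
case: p => // q _ J0 h1 h2 h3; rewrite -pred_Sn.
have g1 : J * (2 * q.+1 * (q * b) + u) <= J * (2 * q.+1 * u + q * q.+1).
  have := leq_mul (leqnn q) h3; have : 2 * q * u <= J * u by rewrite leq_mul2r; lia.
  lia.
rewrite leq_pmul2l // in g1.
have g2 : q * b <= u by rewrite -(@leq_pmul2l (2 * q.+1)) //; lia.
split=> //; have [d e] : exists d, u = d + q * b by exists (u - q * b); lia.
by rewrite {1}e in g1; rewrite {2}e addnK; lia.
Qed.

(** The extremal choice bounds the non-edges [e] of [U] from above, the more strongly the more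
    vertices are discarded; absence of supersaturation bounds them from below. Hence only about
    [2 n / H] vertices are discarded. *)
Lemma deleted_size_bound p J H n u e eV : 0 < J * H -> 0 < n -> u <= n ->
  p * J * e + J.+1 * n ^ 2 <= p * J * eV + J.+1 * u ^ 2 ->
  p * eV <= n ^ 2 + 3 * n ->
  (J * H).-1 * u ^ 2 < p * (J * H) * e + n ^ 2 ->
  H * (n - u) <= 2 * n + 3 * J * H.
Proof.
move=> J'0 n0 un h1 h2 h3.
have g1 : J * (p * e) + n ^ 2 <= 3 * J * n + J.+1 * u ^ 2.
  by have := leq_mul (leqnn J) h2; lia.
have g2 : J * H * u ^ 2 < J * H * (p * e) + n ^ 2 + u ^ 2.
  case: (J * H) J'0 h3 => // t _; rewrite -pred_Sn; lia.
have g3 : H * n ^ 2 < n ^ 2 + 3 * J * H * n + (H + 1) * u ^ 2.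
  by have := leq_mul (leqnn H) g1; lia.
have [r e1] : exists r, n = u + r by exists (n - u); lia.
have g4 : H * r * n <= (2 * n + 3 * J * H) * n.
  have q : n ^ 2 = u ^ 2 + r * n + r * u by rewrite e1 -!mulnn; lia.
  have q2 : u ^ 2 <= n ^ 2 by rewrite leq_sqr.
  have q3 : H * n ^ 2 = H * u ^ 2 + H * r * n + H * r * u by rewrite q; lia.
  move: q2 g3; rewrite q3; have := mulnn n; lia.
by move: g4; rewrite leq_pmul2r // e1 addKn.
Qed.

Lemma stability p s K : 2 <= p -> 0 < K -> exists n0, forall (V : finType) (G : sgraph V),
  n0 <= #|V| -> p * nonedges2 G setT <= #|V| ^ 2 + 3 * #|V| ->
  clq G p.+1 setT * #|V| ^ 2 <= s * #|V| ^ p ->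
  exists c : V -> 'I_p, K * inner2 G c <= #|V| ^ 2.
Proof.
(* [J] governs the minimum degree of [U], [H] the number of discarded vertices: unclassed vertices
   number at most about [n / J] inside [U] and [2 n / H] outside, so both grow with [K]. *)
move=> p2 K0; pose J := 8 * K + 2 * p; pose H := 16 * K; pose J' := J * H.
(* Supersaturation of [U] would force [n ^ 3 <= c1], and the lack of an isolated clique would force
   [n <= c2]. *)
pose c1 := (2 * J' ^ 2) ^ p.+1 * p.+1`! * s.
pose c2 := (8 * p) ^ p * p`! * 2 ^ p.+1 * s.
have J0 : 0 < J by rewrite /J; lia.
have J'0 : 0 < J' by rewrite muln_gt0 J0 /H; lia.
exists (c1 + c2 + p * J' ^ 2 + 12 * J * K + 2 * p * J + 4 * p ^ 2 + 1) => V G.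
set n := #|V| => hn hE hN.
have p0 : 0 < p by lia.
have nc1 : c1 < n by lia. 
have nc2 : c2 < n by lia. 
have nJ' : p * J' ^ 2 <= n by lia.
have nJ : 12 * J * K + 2 * p * J + 4 * p ^ 2 <= n by lia.
have J2p : 2 * p <= J by rewrite /J; lia.
clear hn; have n0 : 0 < n by lia.
have [U [_ hU dU]] := min_degree_subset G setT J.+1 (p * J).
rewrite cardsT -/n in hU.
have nsat : J'.-1 * #|U| ^ 2 < p * J' * nonedges2 G U + n ^ 2.
  rewrite ltnNge; apply/negP => /(supersaturation p0 J'0)[L hL cL].
  have {}hL : n <= 2 * J' ^ 2 * L by lia.
  have : n ^ p.+1 * n ^ 2 <= (2 * J' ^ 2) ^ p.+1 * p.+1`! * (s * n ^ p).
    apply: (@leq_trans ((2 * J' ^ 2 * L) ^ p.+1 * n ^ 2)); first by rewrite leq_mul2r leq_exp2r ?hL ?orbT.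
    rewrite expnMn; apply: (@leq_trans ((2 * J' ^ 2) ^ p.+1 * p.+1`! * (clq G p.+1 setT * n ^ 2))).
      have {}cL : L ^ p.+1 <= p.+1`! * clq G p.+1 setT.
        by apply: (leq_trans cL); rewrite leq_mul2l clq_sub ?subsetT ?orbT.
      by apply: (leq_trans (leq_mul (leq_mul (leqnn _) cL) (leqnn _))); rewrite -!mulnA.
    by rewrite leq_mul2l hN orbT.
  have -> : n ^ p.+1 * n ^ 2 = n ^ 3 * n ^ p by rewrite -!expnD; congr (n ^ _); lia.
  rewrite mulnA -/c1 leq_pmul2r ?expn_gt0 ?n0 // leqNgt (leq_trans nc1) //.
  by rewrite -[X in X <= _]expn1 leq_pexp2l.
have un : #|U| <= n by apply: max_card.
have hr : H * (n - #|U|) <= 2 * n + 3 * J * H.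
  exact: (deleted_size_bound J'0 n0 un hU hE nsat).
have hrK : 2 * K * (n - #|U|) * 4 <= n + 24 * J * K by move: hr; rewrite /H; lia.
have hu : n <= 2 * #|U| by clear - K0 nJ hrK; have := leq_pmull (n - #|U|) K0; lia.
have hpp : p * p <= #|U| by clear - nJ hu; rewrite mulnn; lia.
pose b := (2 * J.+1 * #|U| + p * J) %/ (2 * (p * J)).
pose L := #|U| - p.-1 * b.
have hb : p.-1 * b <= #|U| /\ #|U| <= 2 * p * (#|U| - p.-1 * b) + p.-1 * p.
  have : b * (2 * (p * J)) <= 2 * J.+1 * #|U| + p * J by exact: leq_divM.
  exact: greedy_bound.
have hL : n <= 8 * p * L.
  have : p.-1 * p <= p ^ 2 by rewrite -mulnn leq_mul2r leq_pred orbT.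
  by move: hb => [_]; clear - nJ hu; rewrite -/L; lia.
have qU : L ^ p <= p`! * clq G p U.
  apply: (greedy_cliques (b := b)) => [x xU|_].
    rewrite leq_divRL; last by rewrite !muln_gt0 p0 J0.
    by rewrite mulnC; apply: dU.
  by rewrite subnK // (proj1 hb).
have [Q qQ isoQ] : exists2 Q, Q \in cliques G p U & isolated_clique G p Q.
  apply: isolated_clique_exists => //; rewrite ltnNge; apply/negP => bad.
  have : n ^ p * n ^ 2 <= (8 * p) ^ p * p`! * (2 ^ p.+1 * n) * (s * n ^ p).
    apply: (@leq_trans ((8 * p * L) ^ p * n ^ 2)); first by rewrite leq_mul2r leq_exp2r ?hL ?orbT.
    rewrite expnMn; apply: (@leq_trans ((8 * p) ^ p * (p`! * (clq G p.+1 setT * (2 ^ p.+1 * n))) * n ^ 2)).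
      rewrite leq_mul2r leq_mul2l (leq_trans qU) ?orbT // leq_mul2l bad orbT //.
    by have := leq_mul (leqnn ((8 * p) ^ p * p`! * (2 ^ p.+1 * n))) hN; lia.
  have -> : (8 * p) ^ p * p`! * (2 ^ p.+1 * n) * (s * n ^ p) = n ^ p * (c2 * n) by clear; rewrite /c2; lia.
  by rewrite leq_pmul2l ?expn_gt0 ?n0 // -mulnn leq_pmul2r // leqNgt nc2.
have qQT : Q \in cliques G p setT.
  by move: qQ; rewrite !inE subsetT => /and3P[-> -> _].
have [c hc] := class_colouring p2 qQT isoQ; exists c.
have := sum_missed U p2 qQT isoQ; set X := unclassed G Q in hc * => hs.
(* Each of the [p] vertices of [Q] misses about [(1 + 1/J) #|U| / p] vertices of [U], so the excess
   in [sum_missed] is about [#|U| / J]. *)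
have hX : 2 * J * #|U :&: X| <= 2 * n + p * J.
  have : \sum_(x in Q) 2 * (p * J) * #|U :\: nb G x| <= \sum_(x in Q) (2 * J.+1 * #|U| + p * J).
    apply: leq_sum => x xQ; apply: dU; move: qQ; rewrite inE => /and3P[_ _ /subsetP]; exact.
  have -> : \sum_(x in Q) (2 * J.+1 * #|U| + p * J) = p * (2 * J.+1 * #|U| + p * J).
    by rewrite sum_nat_const; move: qQ; rewrite inE => /and3P[/eqP -> _].
  rewrite -big_distrr /= => h1; have := leq_mul (leqnn (2 * (p * J))) hs => h2.
  have : p * (2 * J * (#|U| + #|U :&: X|)) <= p * (2 * J.+1 * #|U| + p * J) by clear - h1 h2; lia.
  clear - un p0; rewrite leq_pmul2l //; lia.
have cX : #|X| <= (n - #|U|) + #|U :&: X|.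
  rewrite -(cardsID U X) [X :&: U]setIC addnC leq_add2r.
  have -> : n - #|U| = #|~: U| by rewrite /n -(cardsC U) addKn.
  by rewrite subset_leq_card // setDE subsetIr.
apply: leq_trans (leq_mul (leqnn K) (inner2_cover hc)) _.
rewrite -/n !mulnA -mulnn leq_pmul2r //.
have : 16 * K * #|U :&: X| <= 2 * n + p * J by clear - hX; rewrite /J in hX; lia.
have := leq_mul (leqnn (2 * K)) cX; clear - hrK nJ; lia.
Qed.

(** * Turan partitions *)

Section Parts.
Variables (V : finType) (p : nat) (c : V -> 'I_p).

Lemma card_part (i : nat) : #|part c i| = \sum_x (val (c x) == i).
Proof. by rewrite -sum1_card big_mkcond; apply: eq_bigr => x _; rewrite inE; case: ifP. Qed.

Lemma sum_part (F : nat -> nat) : \sum_x F (c x) = \sum_(i < p) #|part c i| * F i.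
Proof.
rewrite (partition_big c predT) //=; apply: eq_bigr => i _.
rewrite (eq_bigr (fun=> F i)) => [|x /eqP -> //].
rewrite sum_nat_const; congr (_ * _); apply: eq_card => x.
by rewrite unfold_in inE.
Qed.

Lemma sum_card_part : \sum_(i < p) #|part c i| = #|V|.
Proof.
have := sum_part (fun=> 1); rewrite sum1_card => ->.
by apply: eq_bigr => i _; rewrite muln1.
Qed.

Lemma card_nb_multipartite x : #|nb (complete_multipartite c) x| + #|part c (c x)| = #|V|.
Proof.
rewrite -(cardsC (part c (c x))) addnC; congr (_ + _); apply: eq_card => y.
by rewrite !inE /= /multipartite_rel val_eqE eq_sym.
Qed.

Lemma multipartite_edges :
  (num_edges (complete_multipartite c)).*2 + \sum_(i < p) #|part c i| ^ 2 = #|V| ^ 2.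
Proof.
have -> : \sum_(i < p) #|part c i| ^ 2 = \sum_x #|part c (c x)|.
  by rewrite (sum_part (fun i => #|part c i|)); apply: eq_bigr => i _; rewrite mulnn.
rewrite num_edges2 -big_split /= (eq_bigr (fun=> #|V|)) => [|x _]; last exact: card_nb_multipartite.
by rewrite sum_nat_const mulnn.
Qed.

End Parts.

(* This is [(a - f) * (a - f - 1)] without truncation; summed over the parts, it is
   twice the number of edges fewer than in the Turan graph. *)
Definition defect f a := a ^ 2 + f * f.+1 - f.*2.+1 * a.

Lemma defectE f a : defect f a + f.*2.+1 * a = a ^ 2 + f * f.+1.
Proof.
rewrite /defect subnK // -mulnn; have [le|lt] := leqP a f.
  by have [d ->] : exists d, f = a + d; [exists (f - a); lia | nia].
by have [d ->] : exists d, a = f + d.+1; [exists (a - f).-1; lia | nia].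
Qed.

Lemma defect_eq0 f a : defect f a = 0 <-> a = f \/ a = f.+1.
Proof.
have h := defectE f a; rewrite -mulnn in h; split; last by case=> e; rewrite e in h *; nia.
move=> e; rewrite e in h; have [le|lt] := leqP a f.
  by have [d e1] : exists d, f = a + d; [exists (f - a); lia | nia].
by have [d e1] : exists d, a = f + d.+1; [exists (a - f).-1; lia | nia].
Qed.

Lemma defect_lower f a : 2 * (f - a) <= defect f a.
Proof.
have := defectE f a; rewrite -mulnn; have [le|lt] := leqP a f; last lia.
by have [d ->] : exists d, f = a + d; [exists (f - a); lia | nia].
Qed.

Lemma defect_sq f a : (f - a) ^ 2 <= defect f a.
Proof.
have := defectE f a; rewrite -!mulnn; have [le|lt] := leqP a f; last lia.
by have [d ->] : exists d, f = a + d; [exists (f - a); lia | nia].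
Qed.

Section Turan.
Variables (V : finType) (p : nat).
Hypothesis p0 : 0 < p.
Local Notation n := #|V|.
Local Notation f := (n %/ p).

(** The linear terms of the defects add up to a constant, since the part sizes sum to [n]; so twice
    the edge count is a constant minus the total defect. *)
Lemma multipartite_defect (c : V -> 'I_p) :
  (num_edges (complete_multipartite c)).*2 + f.*2.+1 * n + \sum_(i < p) defect f #|part c i|
  = n ^ 2 + p * (f * f.+1).
Proof.
rewrite -(multipartite_edges c) -(sum_card_part c) big_distrr /= -!addnA; congr (_ + _).
rewrite -big_split /= -[X in X * _](card_ord p) -sum_nat_const -big_split /=.
by apply: eq_bigr => i _; rewrite addnC defectE sum_card_part.
Qed.

Lemma sum_mod_eq m j : j < p -> \sum_(i < m) (i %% p == j) = (m + p.-1 - j) %/ p.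
Proof.
move=> jp; elim: m => [|m IH]; first by rewrite big_ord0 divn_small //; lia.
rewrite big_ord_recr /= IH.
have -> : m.+1 + p.-1 - j = (m + p.-1 - j).+1 by lia.
rewrite divnS // addnC; congr (nat_of_bool _ + _).
have -> : (m + p.-1 - j).+1 = m + (p - j) by lia.
rewrite {2}(divn_eq m p) -addnA dvdn_addr ?dvdn_mull //.
have := ltn_pmod m p0; set r := m %% p => rp.
apply/eqP/idP => [->|]; first by rewrite subnKC // ltnW.
case/dvdnP => -[|[|k]]; lia.
Qed.

(** Residues of ranks give part sizes that differ by at most one and already decrease with the
    index, as the definition of [Y] demands. *)
Definition balanced (x : V) : 'I_p := Ordinal (ltn_pmod (enum_rank x) p0).

Lemma card_balanced j : j < p -> #|part balanced j| = (n + p.-1 - j) %/ p.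
Proof.
move=> jp; rewrite -sum_mod_eq // card_part (reindex _ (onW_bij _ (enum_val_bij V))) /=.
by apply: eq_bigr => i _; rewrite enum_valK.
Qed.

Lemma balanced_sorted i j : i <= j < p -> #|part balanced j| <= #|part balanced i|.
Proof.
case/andP=> ij jp; rewrite !card_balanced ?(leq_ltn_trans ij jp) //.
by apply: leq_div2r; lia.
Qed.

Lemma balanced_defect j : j < p -> defect f #|part balanced j| = 0.
Proof.
move=> jp; apply/defect_eq0; rewrite card_balanced //.
have : f <= (n + p.-1 - j) %/ p by apply: leq_div2r; lia.
have : (n + p.-1 - j) %/ p <= f.+1.
  by rewrite -addn1 -(divnDMl _ _ p0) mul1n leq_div2r //; lia.
lia.
Qed.

Lemma turan_partitionP (c : V -> 'I_p) :
  turan_partition c <-> forall i : 'I_p, defect f #|part c i| = 0.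
Proof.
split=> [h i|h c'].
  have := h balanced; have := multipartite_defect c; have := multipartite_defect balanced.
  rewrite (eq_bigr (fun=> 0)) => [|j _]; last exact: balanced_defect.
  rewrite big1 // (bigD1 i) //=; lia.
have := multipartite_defect c; rewrite big1 //.
have := multipartite_defect c'; lia.
Qed.

End Turan.

(** The product of [m] part sizes of which [h] equal [f.+1] and the others [f]. *)
Definition balprod f m h := f.+1 ^ h * f ^ (m - h).

Lemma balprod_leq f m h h' : h <= h' <= m -> balprod f m h <= balprod f m h'.
Proof.
case/andP=> h1 h2; rewrite /balprod.
have -> : m - h = (h' - h) + (m - h') by lia.
have -> : f.+1 ^ h' = f.+1 ^ h * f.+1 ^ (h' - h) by rewrite -expnD subnKC.
rewrite expnD mulnA leq_mul2r leq_mul2l.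
by case: (h' - h) => [|k]; rewrite ?leqnn ?orbT // leq_exp2r ?leqnSn ?orbT.
Qed.

Lemma balprod_max f m h : h <= m -> balprod f m h <= f.+1 ^ m.
Proof.
move=> hm; rewrite /balprod -[X in _ <= _ ^ X](subnKC hm) expnD leq_mul2l.
by case: (m - h) => [|k]; rewrite ?orbT // leq_exp2r ?leqnSn ?orbT.
Qed.

(** Zero defect allows only the sizes [f] and [f.+1]; the sum then tells how many are [f.+1], and so
    determines the product. *)
Lemma prod_balanced (I : finType) (S : {set I}) (a : I -> nat) f :
  (forall i, i \in S -> defect f (a i) = 0) ->
  \prod_(i in S) a i = balprod f #|S| (\sum_(i in S) a i - #|S| * f) /\
  #|S| * f <= \sum_(i in S) a i <= #|S| * f + #|S|.
Proof.
move=> hS; pose h := #|[set i in S | a i == f.+1]|.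
have hE i : i \in S -> a i = f + (a i == f.+1).
  by move=> /hS/defect_eq0[]->; rewrite ?eqxx ?addn1 // -[f in f == _]addn0 -addn1 eqn_add2l addn0.
have cE : \sum_(i in S) (a i == f.+1 : nat) = h.
  by rewrite /h -sum1_card big_mkcond [RHS]big_mkcond; apply: eq_bigr => i _; rewrite inE; case: (i \in S) => //; case: eqP.
have sE : \sum_(i in S) a i = #|S| * f + h.
  by rewrite (eq_bigr _ hE) big_split /= sum_nat_const cE.
have hle : h <= #|S| by apply/subset_leq_card/subsetP => i; rewrite inE => /andP[].
rewrite sE addKn leq_addr leq_add2l hle; split=> //.
rewrite /balprod (bigID (fun i => a i == f.+1)) /=; congr (_ * _).
  rewrite (eq_bigr (fun=> f.+1)) => [|i /andP[_ /eqP]//].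
  by rewrite prod_nat_const; congr (_ ^ _); apply: eq_card => i; rewrite !inE.
rewrite (eq_bigr (fun=> f)) => [|i /andP[/hE -> ]]; last by case: (a i == _); rewrite ?addn0 // addn1 eqxx.
rewrite prod_nat_const; congr (_ ^ _).
rewrite -(cardsID [set i | a i == f.+1] S).
have -> : S :&: [set i | a i == f.+1] = [set i in S | a i == f.+1] by apply/setP => i; rewrite !inE.
by rewrite addKn; apply: eq_card => i; rewrite !inE andbC.
Qed.

(** * The graph Y *)

Section YGraph.
Variables (W : finType) (p s : nat) (Y : sgraph W) (c : W -> 'I_p) (u v : W) (X1 : {set W}).
Local Notation n := #|W|.
Local Notation f := (n %/ p).
Hypotheses (p2 : 2 <= p) (s0 : 1 <= s) (sf : s <= f).
Hypothesis turan_c : turan_partition c.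
Hypothesis sorted_c : forall i j, i <= j < p -> #|part c j| <= #|part c i|.
Hypotheses (u_part : u \in part c 0) (v_part : v \in part c 0) (u_neq_v : u != v).
Hypotheses (sX1 : X1 \subset part c p.-1) (cX1 : #|X1| = s).
Local Notation X2 := (part c p.-1 :\: X1).
Hypothesis YE : forall x y, Y x y = Y_rel c u v X2 x y.

Let p0 : 0 < p. Proof. exact: ltnW. Qed.
Let last_lt : p.-1 < p. Proof. by rewrite prednK. Qed.
Let first_part : 'I_p := Ordinal p0.
Let last_part : 'I_p := Ordinal last_lt.
Let first_neq_last : first_part != last_part.
Proof. by rewrite -val_eqE /=; lia. Qed.
Let middle : {set 'I_p} := [set i | (i != first_part) && (i != last_part)].
Let cu : c u = first_part.
Proof. by apply/val_inj; move: u_part; rewrite inE => /eqP. Qed.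
Let cv : c v = first_part.
Proof. by apply/val_inj; move: v_part; rewrite inE => /eqP. Qed.

Let part_cases (i : 'I_p) : #|part c i| = f \/ #|part c i| = f.+1.
Proof. by apply/defect_eq0; apply: (iffLR (turan_partitionP p0 c)). Qed.

Let Y_uv : Y u v.
Proof. by rewrite YE /Y_rel eqxx. Qed.

Let Y_eq x y : [set x; y] != [set u; v] ->
  Y x y = [&& c x != c y, ~~ ((x == u) && (y \in X2)) & ~~ ((y == u) && (x \in X2))].
Proof. by move=> h; rewrite YE /Y_rel (negbTE h). Qed.

(** If the smallest part had [f.+1] vertices, so would all, and their sum would exceed [n]. *)
Let last_size : #|part c p.-1| = f.
Proof.
have [//|e] := part_cases last_part; rewrite /= in e.
have : \sum_(i < p) f.+1 <= n.
  rewrite -[X in _ <= X](sum_card_part c); apply: leq_sum => i _.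
  apply: leq_trans (_ : #|part c p.-1| <= _); first by rewrite e.
  by apply: sorted_c; have := ltn_ord i; rewrite last_lt; lia.
rewrite sum_nat_const card_ord mulnC => h.
by have := ltn_ceil n p0; lia.
Qed.

(** This is [e(Y) >= e(T) - f + s + 1], doubled, with the edge count of the Turan graph in the
    closed form of [multipartite_defect] and without truncated subtraction. *)
Lemma Y_num_edges :
  n ^ 2 + p * (f * f.+1) + 2 * s.+1 <= (num_edges Y).*2 + 2 * f + f.*2.+1 * n.
Proof.
have := multipartite_defect c; rewrite big1; last first.
  by move=> i _; apply: (iffLR (turan_partitionP p0 c)).
rewrite addn0 !num_edges2.
have cX2 : #|X2| + s = f by rewrite -last_size -cX1 addnC -(cardsID X1 (part c p.-1)) (setIidPr sX1).
have nbE (H : sgraph W) : \sum_x #|nb H x| = \sum_x \sum_y (H x y : nat).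
  apply: eq_bigr => x _; rewrite -sum1_card [LHS]big_mkcond; apply: eq_bigr => y _.
  by rewrite inE; case: (H x y).
have sum_set (z : W) (A : {set W}) : \sum_x \sum_y ((x == z) && (y \in A) : nat) = #|A|.
  rewrite (bigD1 z) //= eqxx /= [X in _ + X]big1 => [|x /negbTE ->]; last by rewrite big1.
  by rewrite addn0 -sum1_card [RHS]big_mkcond; apply: eq_bigr => y _; case: (y \in A).
have sum_set' (z : W) (A : {set W}) : \sum_x \sum_y ((y == z) && (x \in A) : nat) = #|A|.
  by rewrite exchange_big /= sum_set.
(* The adjacency matrices are compared entry by entry: the edge [u v] adds two entries, the deletion
   removes two copies of [X2]. *)
have : \sum_x \sum_y (complete_multipartite c x y : nat) + #|[set v]| + #|[set u]| <=
       \sum_x \sum_y (Y x y : nat) + #|X2| + #|X2|.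
  rewrite -(sum_set u [set v]) -(sum_set v [set u]) -{1}(sum_set u X2) -(sum_set' u X2).
  rewrite -!big_split /=; apply: leq_sum => x _.
  rewrite -!big_split /=; apply: leq_sum => y _.
  rewrite !in_set1 YE /Y_rel /= /multipartite_rel.
  have h1 : (x == u) && (y == v) -> ([set x; y] == [set u; v]) && (c x == c y).
    by case/andP=> /eqP -> /eqP ->; rewrite cu cv !eqxx.
  have h2 : (x == v) && (y == u) -> ([set x; y] == [set u; v]) && (c x == c y).
    by case/andP=> /eqP -> /eqP ->; rewrite cu cv setUC !eqxx.
  have h3 : ~~ ((x == u) && (x == v)).
    by apply: contraNN u_neq_v => /andP[/eqP <-].
  move: h1 h2 h3; case: ([set x; y] == _); case: (c x == c y); case: (x == u);
    case: (x == v); case: (y == u); case: (y == v); case: (y \in X2); case: (x \in X2) => //=;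
    move=> h1 h2; by [have := h1 isT|have := h2 isT].
by rewrite !cards1 -!nbE; lia.
Qed.

(** The only edge of [Y] inside a part is [u v], so by pigeonhole a [K_{p+1}] contains both ends
    and, without [v], has one vertex per part. *)
Let Y_clique_pair S : S \in cliques Y p.+1 setT ->
  [/\ u \in S, v \in S & {in S :\ v &, injective c}].
Proof.
rewrite inE subsetT andbT => /andP[/eqP cS /is_cliqueP qS].
have sep x y : x \in S -> y \in S -> [set x; y] != [set u; v] -> c x = c y -> x = y.
  move=> xS yS h e; apply/eqP/negPn/negP => nxy.
  by have := qS x y xS yS nxy; rewrite Y_eq // e eqxx.
have both : (u \in S) && (v \in S).
  apply/negPn/negP => nb.
  have : #|c @: S| <= p by rewrite -[X in _ <= X](card_ord p) max_card.
  rewrite card_in_imset ?cS ?ltnn // => x y xS yS; apply: sep => //.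
  apply: contraNneq nb => e; move: (set21 u v) (set22 u v); rewrite -e !in_set2.
  by move=> /orP[]/eqP-> /orP[]/eqP->; rewrite ?xS ?yS.
case/andP: both => uS vS; split=> // x y /setD1P[nxv xS] /setD1P[nyv yS].
apply: sep => //; apply/eqP => e; have := set22 u v; rewrite -e in_set2.
by rewrite eq_sym (negbTE nxv) eq_sym (negbTE nyv).
Qed.

(** The candidates for the vertex of colour [i] in a [K_{p+1}] with [v] removed. *)
Let Y_box (i : 'I_p) : {set W} :=
  if i == first_part then [set u] else if i == last_part then X1 else part c i.

Let card_middle_box :
  \prod_(i < p) #|Y_box i| = s * \prod_(i in middle) #|part c i|.
Proof.
rewrite (bigD1 first_part) //= (bigD1 last_part) /=; last by rewrite eq_sym.
rewrite {1}/Y_box eqxx cards1 mul1n {1}/Y_box eqxx eq_sym (negbTE first_neq_last) cX1.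
congr (_ * _); apply: eq_big => [i|i /andP[h1 h2]]; first by rewrite inE.
by rewrite /Y_box (negbTE h1) (negbTE h2).
Qed.

(** A clique is encoded by the function [g S] sending each colour to its vertex of that colour in
    [S :\ v]. It can be recovered from this function, whose values lie in the boxes; the default [u]
    in [g] is never taken. *)
Lemma Y_num_cliques_prod :
  num_cliques p.+1 Y <= s * \prod_(i in middle) #|part c i|.
Proof.
rewrite num_cliquesE -card_middle_box.
pose g S : {ffun 'I_p -> W} := [ffun i => odflt u [pick x in S :\ v | c x == i]].
have gP S i : S \in cliques Y p.+1 setT -> g S i \in S :\ v /\ c (g S i) = i.
  move=> hS; have [uS vS inj] := Y_clique_pair hS; rewrite ffunE.
  case: pickP => [x /andP[xS /eqP cx]//|none]; exfalso.
  have cSv : #|S :\ v| = p.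
    by move: hS; rewrite inE => /andP[/eqP + _]; rewrite (cardsD1 v) vS => -[].
  have : c @: (S :\ v) \subset ~: [set i].
    apply/subsetP => _ /imsetP[x xS ->]; rewrite !inE; have := none x; rewrite xS /= => ->.
    by [].
  by move/subset_leq_card; rewrite card_in_imset // cSv cardsC1 card_ord leqNgt ltn_predL p0.
have gimg S : S \in cliques Y p.+1 setT -> S = v |: [set g S i | i : 'I_p].
  move=> hS; have [uS vS inj] := Y_clique_pair hS.
  rewrite -{1}(setD1K vS); congr (_ |: _); apply/setP => x; apply/idP/imsetP => [xS|[i _ ->]].
    by have [h1 h2] := gP S (c x) hS; exists (c x) => //; apply: inj.
  by have [] := gP S i hS.
have : #|[set g S | S in cliques Y p.+1 setT]| <= #|family (fun i => mem (Y_box i))|.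
  apply/subset_leq_card/subsetP => _ /imsetP[S hS ->]; apply/familyP => i.
  have [uS vS inj] := Y_clique_pair hS; have [/setD1P[gv gS] cg] := gP S i hS.
  rewrite /Y_box; case: eqP => [e|/eqP nf]; last case: eqP => [e|_].
  - apply/set1P; apply: inj; rewrite ?cu ?cg // !inE ?gv ?gS ?uS ?u_neq_v //.
  (* A vertex of the last part that is adjacent to [u] lies outside [X2], hence in [X1]. *)
  - have nug : u != g S i by apply: contraNneq nf => e'; rewrite -cg -e' cu.
    move: hS; rewrite inE => /and3P[_ /is_cliqueP qS _].
    have := qS u (g S i) uS gS nug; rewrite Y_eq ?eqxx /=; last first.
      apply/eqP => e'; have := set22 u (g S i); rewrite e' in_set2 (negbTE gv).
      by rewrite orbF eq_sym (negbTE nug).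
    case/and3P=> _; rewrite in_setD inE cg e eqxx andbT negbK //.
  by rewrite inE cg.
rewrite card_in_imset => [|S T hS hT e]; last by rewrite (gimg S hS) (gimg T hT) e.
by rewrite card_family foldrE big_map big_enum.
Qed.

Let cmiddle : #|middle| = p - 2.
Proof.
have := cardsC [set first_part; last_part]; rewrite cards2 first_neq_last card_ord.
have -> : ~: [set first_part; last_part] = middle by apply/setP => i; rewrite !inE negb_or.
by move=> e; apply/eqP; rewrite -(eqn_add2l 2) subnKC // e.
Qed.

Let sum_middle :
  \sum_(i in middle) #|part c i| + #|part c 0| + f = n.
Proof.
have := sum_card_part c; rewrite (bigD1 first_part) //= (bigD1 last_part) /=; last by rewrite eq_sym.
rewrite last_size (eq_bigl [in middle]) => [|i]; last by rewrite !inE.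
by rewrite addnA [_ + f]addnC addnAC -[X in X = _]addnA addnC.
Qed.

(** Exactly [n %% p] parts have [f.+1] vertices. If there are any, the first part is one of them,
    which leaves [n %% p - 1] for the middle; if there are none, [h = 0] agrees with the truncated
    predecessor. *)
Lemma Y_num_cliques : exists2 h, h <= (n %% p).-1 /\ h <= p - 2 &
  num_cliques p.+1 Y <= s * balprod f (p - 2) h.
Proof.
have [e /andP[h1 h2]] := @prod_balanced _ middle (fun i => #|part c i|) f
  (fun i _ => iffLR (turan_partitionP p0 c) turan_c i).
exists (\sum_(i in middle) #|part c i| - #|middle| * f); last by rewrite -cmiddle -e Y_num_cliques_prod.
rewrite -cmiddle; split; last lia.
have := sum_middle; rewrite cmiddle; have := divn_eq n p.
have e2 k : p * k = (p - 2) * k + k + k.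
  by have [q ->] : exists q, p = q + 2; [exists (p - 2); rewrite subnK | rewrite addnK; lia].
rewrite mulnC e2; have [/= a0|/= a0] := part_cases first_part; rewrite a0; last by clear; lia.
move=> e3 e4; suff -> : \sum_(i in middle) #|part c i| = (p - 2) * f by rewrite subnn.
apply/eqP; rewrite eqn_leq -{2}cmiddle h1 andbT; rewrite cmiddle in h1 h2.
have : \sum_(i in middle) #|part c i| <= \sum_(i in middle) #|part c 0|.
  by apply: leq_sum => i _; apply: sorted_c; rewrite ltn_ord.
by rewrite sum_nat_const cmiddle a0.
Qed.

(** Any transversal of the parts other than the first, with its last vertex in [X1], extends the
    edge [u v]; the greedy choice loses nothing, so [b = 0]. *)
Lemma Y_has_clique : 0 < clq Y p.+1 setT.
Proof.
pose D (i : 'I_p) := if i == last_part then X1 else part c i.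
have -> : p.+1 = (p.-2).+3 by lia.
have DE i x : x \in D i -> c x = i.
  rewrite /D; case: eqP => [->|_].
    by move/(subsetP sX1); rewrite inE => /eqP h; apply: val_inj.
  by rewrite inE => /eqP h; apply: val_inj.
have sz : size (enum (~: [set first_part])) = (p.-2).+1.
  by have := cardsC [set first_part]; rewrite cards1 card_ord -cardE; lia.
have uvS : \bigcup_(i <- enum (~: [set first_part])) D i \subset nb Y u :&: nb Y v.
  rewrite bigcup_seq; apply/bigcupsP => i; rewrite mem_enum !inE => nf.
  apply/subsetP => x xD; have cx := DE _ _ xD.
  have xu : x != u by apply: contraNneq nf => e; rewrite -cx e cu.
  have xv : x != v by apply: contraNneq nf => e; rewrite -cx e cv.
  have xX2 : x \notin X2.
    move: xD; rewrite /D in_setD inE cx; case: eqP => [-> ->//|/eqP nl _].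
    by rewrite (_ : (val i == p.-1) = false) ?andbF //; apply: negbTE; rewrite -val_eqE in nl.
  rewrite !inE !Y_eq ?cu ?cv ?cx.
  - rewrite [first_part == _]eq_sym nf (negbTE xX2) (negbTE xu) [v == u]eq_sym (negbTE u_neq_v) /= !andbF //.
  - by apply/eqP => e; have := set22 v x; rewrite e in_set2 (negbTE xu) (negbTE xv).
  by apply/eqP => e; have := set22 u x; rewrite e in_set2 (negbTE xu) (negbTE xv).
apply: leq_trans (clq_nb2 _ Y_uv); apply: leq_trans (clq_sub _ _ uvS); rewrite -sz.
apply: leq_trans (@greedy_transversal _ Y _ c _ D 0 (enum_uniq _) _ _).
- rewrite muln0 prodn_gt0 // => i; rewrite subn0 /D; case: eqP => _; first by rewrite cX1.
  by case: (part_cases i) => -> //; apply: leq_trans s0 sf.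
- by move=> i x _; apply: DE.
move=> i j x hi hj nij xD; rewrite leqn0 cards_eq0 setD_eq0; apply/subsetP => y yD.
move: hi hj; rewrite !mem_enum !inE => ni nj.
have cx := DE _ _ xD; have cy := DE _ _ yD.
have xu : x != u by apply: contraNneq ni => e; rewrite -cx e cu.
have xv : x != v by apply: contraNneq ni => e; rewrite -cx e cv.
have yu : y != u by apply: contraNneq nj => e; rewrite -cy e cu.
rewrite Y_eq ?cx ?cy ?nij ?(negbTE xu) ?(negbTE yu) //.
by apply/eqP => e; have := set21 x y; rewrite e in_set2 (negbTE xu) (negbTE xv).
Qed.

End YGraph.

Lemma Y_exists p s n : 2 <= p -> 1 <= s -> s <= n %/ p -> 2 * p <= n ->
  exists Y : sgraph 'I_n, is_Y n p s Y.
Proof.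
move=> p2 s1 sf pn; have p0 : 0 < p by lia.
pose c : 'I_n -> 'I_p := balanced p0.
have turan_c : turan_partition c.
  by apply/(turan_partitionP p0) => i; apply: balanced_defect.
have f0 : 1 < n %/ p by rewrite leq_divRL // mulnC; lia.
have big j : j < p -> n %/ p <= #|part c j|.
  by move=> jp; have /defect_eq0 := balanced_defect 'I_n p0 jp; rewrite !card_ord -/c => -[] ->.
have [u [v [hu hv uv]]] : exists u v, [/\ u \in part c 0, v \in part c 0 & u != v].
  by have /card_gt1P[u [v [hu hv uv]]] : 1 < #|part c 0|; [exact: leq_trans f0 (big _ p0)|exists u, v].
have [X1 sX1 cX1] : exists2 X : {set 'I_n}, X \subset part c p.-1 & #|X| = s.
  have : s <= #|part c p.-1| by apply: leq_trans sf (big _ _); rewrite prednK.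
  case/card_geqP => t [ut st sub]; exists [set x in t].
    by apply/subsetP => x; rewrite inE => /sub.
  by rewrite cardsE -st; apply/card_uniqP.
pose R := Y_rel c u v (part c p.-1 :\: X1).
have symR : symmetric R.
  move=> x y; rewrite /R /Y_rel [in LHS]setUC [complete_multipartite c x y]adjC.
  by congr (_ || (_ && _)); rewrite andbC.
have irrR : irreflexive R.
  move=> x; rewrite /R /Y_rel adj_irr /= orbF setUid; apply/eqP => e.
  by have := cards2 u v; rewrite -e cards1 uv.
exists (SGraph symR irrR); split; first by split=> //; [lia|rewrite card_ord].
by exists c, u, v, X1; split=> // i j; apply: balanced_sorted.
Qed.

(** * Monochromatic edges and missing pairs *)

Lemma sum_mem (T : finType) (A : pred T) : \sum_x (A x : nat) = #|A|.
Proof. by rewrite -sum1_card [RHS]big_mkcond; apply: eq_bigr => x _; rewrite unfold_in; case: (A x). Qed.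

Section Colouring.
Variables (V : finType) (G : sgraph V) (p : nat).
Implicit Types (c : V -> 'I_p) (x y u v : V).

Definition inner_deg c x := #|[set y in nb G x | c y == c x]|.
Definition missing c x y := (c x != c y) && ~~ G x y.
Definition missing_deg c x := #|[set y | missing c x y]|.
Definition missing2 c := \sum_x missing_deg c x.

Lemma inner_degE c x : inner_deg c x = \sum_y (G x y && (c y == c x)).
Proof. by rewrite sum_mem; apply: eq_card => y; rewrite !inE. Qed.

Lemma missing_degE c x : missing_deg c x = \sum_y missing c x y.
Proof. by rewrite sum_mem; apply: eq_card => y; rewrite !inE. Qed.

Lemma missingC c x y : missing c x y = missing c y x.
Proof. by rewrite /missing eq_sym adjC. Qed.

Lemma inner2E c : inner2 G c = \sum_x inner_deg c x.
Proof. by []. Qed.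

Lemma edges_missing c : 
  (num_edges G).*2 + missing2 c = (num_edges (complete_multipartite c)).*2 + inner2 G c.
Proof.
rewrite !num_edges2 inner2E -!big_split /=; apply: eq_bigr => x _.
rewrite inner_degE missing_degE -!sum1_card ![in \sum_(y in nb _ _) _]big_mkcond -!big_split /=.
apply: eq_bigr => y _; rewrite !inE /= /multipartite_rel /missing [c y == _]eq_sym.
by case: (c x == c y); case: (G x y).
Qed.

Lemma card_partD_nb c x (i : 'I_p) : c x != i ->
  #|part c i :\: nb G x| = \sum_y ((c y == i) && missing c x y).
Proof.
move=> h; rewrite sum_mem; apply: eq_card => y; rewrite !inE unfold_in val_eqE /missing.
by case: eqP => [->|]; rewrite ?h ?andbT ?andbF.
Qed.

Lemma partD_nb_leq c x (i : 'I_p) : c x != i -> #|part c i :\: nb G x| <= missing_deg c x.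
Proof.
by move=> h; rewrite card_partD_nb // missing_degE; apply: leq_sum => y _; case: (_ == _).
Qed.

Lemma inner2_split c v :
  inner2 G c = 2 * inner_deg c v + \sum_(x | x != v) \sum_(y | y != v) (G x y && (c y == c x)).
Proof.
rewrite inner2E (bigD1 v) //= mul2n -addnn -addnA; congr (_ + _).
transitivity (\sum_(x | x != v) (G x v && (c v == c x) + \sum_(y | y != v) (G x y && (c y == c x)))).
  by apply: eq_bigr => x _; rewrite inner_degE (bigD1 v).
rewrite big_split /=; congr (_ + _).
rewrite inner_degE [RHS](bigD1 v) //= adj_irr add0n.
by apply: eq_bigr => x _; rewrite adjC eq_sym.
Qed.

(** Recolouring [v] with [j] changes only the monochromatic edges at [v], and cannot lower their
    number. *)
Lemma min_inner_deg c v (j : 'I_p) : (forall c', inner2 G c <= inner2 G c') ->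
  inner_deg c v <= #|nb G v :&: part c j|.
Proof.
pose c' x := if x == v then j else c x; move=> /(_ c').
rewrite (inner2_split c v) (inner2_split c' v).
have -> : \sum_(x | x != v) \sum_(y | y != v) (G x y && (c' y == c' x)) =
          \sum_(x | x != v) \sum_(y | y != v) (G x y && (c y == c x)).
  apply: eq_bigr => x /negbTE nx; apply: eq_bigr => y /negbTE ny.
  by rewrite /c' nx ny.
rewrite leq_add2r leq_pmul2l // => /leq_trans; apply.
apply/subset_leq_card/subsetP => y; rewrite !inE /c' eqxx val_eqE => /andP[gvy].
have := adj_neq gvy; rewrite eq_sym => /negbTE ->; by rewrite gvy.
Qed.

(** Only missing pairs inside [S] are counted from both ends, and [#|S| ^ 2] bounds the ordered
    pairs there. *)
Lemma sum_missing_set c (S : {set V}) :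
  2 * \sum_(x in S) missing_deg c x <= missing2 c + #|S| ^ 2.
Proof.
have e1 : \sum_(x in S) missing_deg c x = \sum_x \sum_y ((x \in S) && missing c x y).
  rewrite big_mkcond; apply: eq_bigr => x _; rewrite missing_degE; case: (x \in S) => //=.
  by rewrite big1.
have e2 : \sum_(x in S) missing_deg c x = \sum_x \sum_y ((y \in S) && missing c x y).
  by rewrite e1 exchange_big; apply: eq_bigr => x _; apply: eq_bigr => y _; rewrite missingC.
have e3 : #|S| ^ 2 = \sum_x \sum_y ((x \in S) && (y \in S)).
  rewrite -mulnn -sum_nat_const big_mkcond; apply: eq_bigr => x _.
  by case: (x \in S) => /=; [rewrite sum_mem | rewrite big1].
rewrite mul2n -addnn {1}e1 e2 e3 /missing2 -!big_split; apply: leq_sum => x _.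
rewrite /= missing_degE -!big_split; apply: leq_sum => y _ /=.
by case: (x \in S); case: (y \in S); case: (missing c x y).
Qed.

(** Since [S] avoids class [j], no missing pair is counted from both ends, so each may be counted
    together with its transpose. *)
Lemma sum_missing_parts c (S : {set V}) (a j : 'I_p) :
  {in S, forall x, c x = a} -> j != a ->
  2 * \sum_(x in S) #|part c j :\: nb G x| <= missing2 c.
Proof.
move=> hS nja.
pose d x y : nat := (x \in S) && ((c y == j) && missing c x y).
have e1 : \sum_(x in S) #|part c j :\: nb G x| = \sum_x \sum_y d x y.
  rewrite big_mkcond; apply: eq_bigr => x _; rewrite /d.
  case: (boolP (x \in S)) => [xS|_]; last by rewrite big1.
  by rewrite card_partD_nb // hS // eq_sym.
rewrite e1 mul2n -addnn {2}exchange_big /= -big_split /missing2; apply: leq_sum => x _.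
rewrite /= missing_degE -big_split; apply: leq_sum => y _ /=.
rewrite /d [missing c y x]missingC; case: (missing c x y); rewrite ?andbF ?andbT //.
have inS z : z \in S -> ~~ (c z == j) by move=> zS; rewrite hS // eq_sym.
move: (inS x) (inS y); case: (x \in S); case: (y \in S); case: (c x == j);
  case: (c y == j) => //= h1 h2; by [have := h1 isT|have := h2 isT].
Qed.

(* The two families of missing pairs are disjoint, as are their transposes. *)
Lemma sum_missing_parts_extra c (S : {set V}) (a i j : 'I_p) x0 :
  {in S, forall x, c x = a} -> j != a -> i != a -> i != j -> c x0 != i ->
  2 * (\sum_(x in S) #|part c j :\: nb G x| + #|part c i :\: nb G x0|) <= missing2 c.
Proof.
move=> hS nja nia nij nx0.
pose d x y : nat := ((x \in S) && ((c y == j) && missing c x y)) + ((x == x0) && ((c y == i) && missing c x y)).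
have e1 : \sum_(x in S) #|part c j :\: nb G x| + #|part c i :\: nb G x0| = \sum_x \sum_y d x y.
  under [RHS]eq_bigr do rewrite big_split /=.
  rewrite big_split /=; congr (_ + _).
    rewrite big_mkcond; apply: eq_bigr => x _; case: (boolP (x \in S)) => [xS|_]; last by rewrite big1.
    by rewrite card_partD_nb // hS // eq_sym.
  rewrite card_partD_nb // [RHS](bigD1 x0) //= eqxx [X in _ + X]big1 ?addn0 // => x /negbTE ->.
  by rewrite big1.
rewrite e1 mul2n -addnn {2}exchange_big /= -big_split /missing2; apply: leq_sum => x _.
rewrite /= missing_degE -big_split; apply: leq_sum => y _ /=.
rewrite /d [missing c y x]missingC; case: (missing c x y); rewrite ?andbF ?andbT //.
have inS z : z \in S -> ~~ (c z == j) && ~~ (c z == i).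
  by move=> zS; rewrite hS // ![a == _]eq_sym nja nia.
have ij z : ~~ ((c z == i) && (c z == j)).
  by apply: contraNN nij => /andP[/eqP <- /eqP <-].
have at0 z : z == x0 -> ~~ (c z == i) by move/eqP->.
move: (inS x) (inS y) (ij x) (ij y) (at0 x) (at0 y).
case: (x \in S); case: (y \in S); case: (x == x0); case: (y == x0);
  case: (c x == i); case: (c x == j); case: (c y == i); case: (c y == j) => //= h1 h2 h3 h4 h5 h6;
  by [have := h1 isT|have := h2 isT|have := h5 isT|have := h6 isT].
Qed.

End Colouring.

(** * Structure of an extremal colouring *)

Section Finish.
Variables (V : finType) (G : sgraph V) (p s b f : nat) (c : V -> 'I_p).
Local Notation n := #|V|.
(** The unit [b] separates light vertices from heavy ones, which have at least [b] missing pairs.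
    There are at most [w] heavy vertices, and [w] is also the scale of all error terms. *)
Local Notation w := (p * b).
Local Notation N := (clq G p.+1 setT).
Hypothesis fE : f = n %/ p.
Hypotheses (p2 : 2 <= p) (b0 : 0 < b) (w_small : 200 * w <= f).
Hypothesis inner_small : inner2 G c + 2 * f <= w * b.
Hypothesis min_inner : forall c' : V -> 'I_p, inner2 G c <= inner2 G c'.
Hypothesis many_edges :
  n ^ 2 + p * (f * f.+1) + 2 * s.+1 <= (num_edges G).*2 + 2 * f + f.*2.+1 * n.
Hypothesis few_cliques : N < w ^ p.-1.

Let w0 : 0 < w. Proof. by rewrite muln_gt0 b0 andbT ltnW. Qed.

(** In doubled counts: missing pairs and unbalanced classes are paid for by monochromatic edges and
    by the [f - s - 1] edges that [Y] lacks compared with the Turan graph. *)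
Lemma edge_balance :
  missing2 G c + \sum_(i < p) defect f #|part c i| + 2 * s.+1 <= inner2 G c + 2 * f.
Proof.
have := multipartite_defect c; rewrite -fE; have := edges_missing G c; move: many_edges; clear; lia.
Qed.

Let missing_small : missing2 G c <= w * b.
Proof. by have := edge_balance; move: inner_small; clear; lia. Qed.

Lemma part_lower (i : 'I_p) : f <= #|part c i| + w.
Proof.
have h : (f - #|part c i|) ^ 2 <= w * b.
  apply: leq_trans (defect_sq _ _) _; apply: leq_trans inner_small.
  by have := edge_balance; rewrite (bigD1 i) //=; clear; lia.
have : (f - #|part c i|) ^ 2 <= w ^ 2.
  by rewrite (leq_trans h) // -mulnn leq_mul2l leq_pmull ?orbT // ltnW.
by rewrite leq_sqr; clear; lia.
Qed.

Lemma card_heavy : #|[set x | b <= missing_deg G c x]| <= w.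
Proof.
rewrite -(leq_pmul2r b0) (leq_trans _ missing_small) //.
rewrite -sum_nat_const /missing2 [X in _ <= X](bigID [in [set x | b <= missing_deg G c x]]) /=.
by rewrite (leq_trans _ (leq_addr _ _)) // leq_sum // => x; rewrite inE.
Qed.

(** Discarding the heavy vertices leaves [2 * w] in each set, and light vertices miss fewer than [b]
    in every other class; so each greedy choice has at least [2 * w - p * b = w] options. *)
Lemma rich_transversal (S : {set 'I_p}) (D : 'I_p -> {set V}) :
  (forall i x, x \in D i -> c x = i) -> (forall i, i \in S -> 3 * w <= #|D i|) ->
  w ^ #|S| <= clq G #|S| (\bigcup_(i <- enum S) D i).
Proof.
move=> hD hS; pose R := [set x | b <= missing_deg G c x].
pose D' i := D i :\: R.
have sD i : D' i \subset D i by apply: subsetDl.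
have cD i : i \in S -> 2 * w <= #|D' i|.
  move=> /hS; have := card_heavy; rewrite -/R -(cardsID R (D i)) -/(D' i).
  have := subset_leq_card (subsetIr (D i) R); clear; lia.
have cS : #|S| <= p by rewrite -[X in _ <= X](card_ord p) max_card.
apply: (@leq_trans (clq G (size (enum S)) (\bigcup_(i <- enum S) D' i))); last first.
  rewrite -cardE; apply: clq_sub; rewrite !bigcup_seq; apply/bigcupsP => i iS.
  by rewrite (subset_trans (sD i)) // (bigcup_sup i).
apply: leq_trans (@greedy_transversal _ G _ c _ D' b (enum_uniq _) _ _).
- rewrite big_enum /= -prod_nat_const; apply: leq_prod => i iS; rewrite -cardE.
  rewrite -[X in X <= _](addnK w) addnn -mul2n leq_sub ?cD //.
  by rewrite leq_mul2r cS orbT.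
- by move=> i x _ /(subsetP (sD i)); apply: hD.
move=> i j x _ _ nij xD; have cx := hD _ _ (subsetP (sD i) _ xD).
apply: (@leq_trans (missing_deg G c x)).
  apply: leq_trans (partD_nb_leq G (_ : c x != j)); last by rewrite cx.
  apply/subset_leq_card/setSD/subsetP => y /(subsetP (sD j)) /hD <-.
  by rewrite inE.
by move: xD; rewrite !inE -ltnNge => /andP[/ltnW].
Qed.

Let few_cliques_p : N < w ^ p.
Proof. by apply: leq_trans few_cliques _; rewrite leq_pexp2l ?leq_pred. Qed.

(** Otherwise, by minimality, [v] has [3 * w] neighbours in every class, and the transversals among
    them give [w ^ p] copies of [K_{p+1}]. *)
Lemma inner_deg_small v : inner_deg G c v < 3 * w.
Proof.
rewrite ltnNge; apply/negP => h; move: few_cliques_p; rewrite ltnNge => /negP[].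
have := @rich_transversal setT (fun i => nb G v :&: part c i).
rewrite cardsT card_ord => /(_ _ _)/leq_trans; apply.
- by move=> i x; rewrite !inE => /andP[_ /eqP e]; apply: val_inj.
- by move=> i _; apply: leq_trans h (min_inner_deg _ _ min_inner).
apply: leq_trans (clq_nb _ _ v); apply: clq_sub; rewrite bigcup_seq.
by apply/bigcupsP => i _; apply: subsetIl.
Qed.

(** If all other classes held [3 * w] common neighbours, the edge would lie in [w ^ p.-1] copies of
    [K_{p+1}]. A class with fewer, of size at least [f - w], yields the error [4 * w]. *)
Lemma inner_edge_gap u v : G u v -> c u = c v -> exists2 j : 'I_p, j != c u &
  f <= #|part c j :\: nb G u| + #|part c j :\: nb G v| + 4 * w.
Proof.
move=> guv cuv.
have [/exists_inP[j nj hj]|] :=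
  boolP [exists j in ~: [set c u], #|nb G u :&: nb G v :&: part c j| < 3 * w].
  exists j; first by rewrite !inE in nj.
  have := part_lower j; set A := part c j in hj *.
  have : #|A| <= #|A :\: nb G u| + #|A :\: nb G v| + #|nb G u :&: nb G v :&: A|.
    rewrite -(cardsID (nb G u) A) addnC -addnA leq_add2l.
    rewrite -(cardsID (nb G v) (A :&: nb G u)) addnC leq_add //.
      by apply/subset_leq_card/setSD/subsetIl.
    by rewrite -setIA setIC.
  by move: hj; clear; lia.
rewrite negb_exists_in => /forall_inP h; exfalso.
move: few_cliques; rewrite ltnNge => /negP[].
have := @rich_transversal (~: [set c u]) (fun i => nb G u :&: nb G v :&: part c i).
rewrite cardsC1 card_ord => /(_ _ _)/leq_trans; apply.
- by move=> i x; rewrite !inE => /andP[_ /eqP e]; apply: val_inj.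
- by move=> i /h; rewrite -leqNgt.
have -> : p.+1 = p.-1.+2 by rewrite prednK // ltnW.
apply: leq_trans (clq_nb2 _ guv); apply: clq_sub; rewrite bigcup_seq.
by apply/bigcupsP => i _; apply: subsetIl.
Qed.

Lemma inner_edge_missing u v : G u v -> c u = c v ->
  f <= missing_deg G c u + missing_deg G c v + 4 * w.
Proof.
move=> guv cuv; have [j nj h] := inner_edge_gap guv cuv; rewrite eq_sym in nj.
apply: (leq_trans h); rewrite leq_add2r leq_add // partD_nb_leq //.
by rewrite -cuv.
Qed.

(** Every monochromatic edge meets [B], so [inner2] is at most [6 * w * #|B|]. Inserted in
    [edge_balance] this gives [#|B| (f - 16 w) <= 4 f], which forces [#|B| <= 4] because [f] is at
    least [200 * w]. *)
Lemma inner2_bound : inner2 G c <= 24 * w.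
Proof.
pose B := [set v | f - 4 * w <= 2 * missing_deg G c v].
have h1 : inner2 G c <= #|B| * (6 * w).
  have -> : inner2 G c = \sum_x \sum_y (G x y && (c y == c x)).
    by rewrite inner2E; apply: eq_bigr => x _; rewrite inner_degE.
  apply: (@leq_trans (\sum_(x in B) inner_deg G c x + \sum_(x in B) inner_deg G c x)).
    have e1 : \sum_(x in B) inner_deg G c x = \sum_x \sum_y ((x \in B) && (G x y && (c y == c x))).
      rewrite big_mkcond; apply: eq_bigr => x _; rewrite inner_degE; case: (x \in B) => //=.
      by rewrite big1.
    rewrite {1}e1 e1 [X in _ + X]exchange_big /= -big_split; apply: leq_sum => x _.
    rewrite -big_split; apply: leq_sum => y _ /=.
    rewrite [G y x]adjC [c x == _]eq_sym.
    case: (boolP (G x y)) => [gxy|_]; last by rewrite !andbF.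
    case: (c y =P c x) => [e|_]; last by rewrite !andbF.
    rewrite !andbT; have := inner_edge_missing gxy (esym e).
    have [xB|nx] := boolP (x \in B); first by [].
    have [yB|ny] := boolP (y \in B); first by [].
    by move: nx ny; rewrite !inE; clear; lia.
  rewrite addnn -mul2n -sum_nat_const big_distrr; apply: leq_sum => x _ /=.
  by have := inner_deg_small x; clear; lia.
have h2 : #|B| * (f - 4 * w) <= 2 * missing2 G c.
  rewrite -sum_nat_const /missing2 big_distrr [X in _ <= X](bigID [in B]) /=.
  by rewrite (leq_trans _ (leq_addr _ _)) // leq_sum // => x; rewrite inE.
have h3 : missing2 G c <= inner2 G c + 2 * f by have := edge_balance; clear; lia.
rewrite (leq_trans h1) //; suff : #|B| <= 4.
  by move=> h; rewrite (leq_trans (leq_mul h (leqnn _))) // mulnA.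
rewrite leqNgt; apply/negP => h.
have h4 : #|B| * (f - 16 * w) <= 4 * f.
  have -> : f - 16 * w = f - 4 * w - 12 * w by clear; lia.
  by rewrite mulnBr; move: h1 h2 h3; clear; lia.
have := leq_trans (leq_mul h (leqnn _)) h4; move: w_small w0; clear; lia.
Qed.

(** Let [u] have the most missing pairs. A monochromatic edge avoiding [u] would give three vertices
    with about [3 f / 2] missing pairs in all, whereas [edge_balance] allows only about [f]. *)
Lemma star_center : ~ partite p G -> exists u,
  (exists2 v, G u v & c u = c v) /\ inner2 G c = 2 * inner_deg G c u.
Proof.
move=> npart.
have [/existsP[x /existsP[y /andP[gxy /eqP cxy]]]|none] :=
  boolP [exists x, exists y, G x y && (c x == c y)]; last first.
  case: npart; exists c => x y gxy; apply: contraNneq none => e.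
  by apply/existsP; exists x; apply/existsP; exists y; rewrite gxy e eqxx.
case: (@arg_maxnP _ x predT (missing_deg G c) isT) => u _ maxu.
have cover y1 y2 : G y1 y2 -> c y1 = c y2 -> (u == y1) || (u == y2).
  move=> g12 c12; apply/negPn/negP; rewrite negb_or => /andP[n1 n2].
  have h1 := inner_edge_missing g12 c12.
  have := @sum_missing_set _ G _ c (u |: [set y1; y2]).
  have n12 := adj_neq g12.
  have c3 : #|(u |: [set y1; y2])| = 3.
    by rewrite cardsU1 cards2 !inE negb_or n1 n2 n12.
  have -> : \sum_(x in (u |: [set y1; y2])) missing_deg G c x =
    missing_deg G c u + (missing_deg G c y1 + missing_deg G c y2).
    by rewrite big_setU1 ?inE ?negb_or ?n1 //= big_setU1 ?inE //= big_set1.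
  rewrite c3.
  have := edge_balance; have := inner2_bound; have := maxu y1 isT; have := maxu y2 isT.
  by move: h1 w_small w0; clear; rewrite /=; lia.
exists u; split.
  by have /orP[/eqP->|/eqP->] := cover x y gxy cxy; [exists y | exists x => //; rewrite adjC].
rewrite (inner2_split G c u) big1 ?addn0 // => y1 n1; rewrite big1 // => y2 n2.
apply/eqP; rewrite eqb0; apply/negP => /andP[g12 /eqP e].
by have := cover y1 y2 g12 (esym e); rewrite ![u == _]eq_sym (negbTE n1) (negbTE n2).
Qed.

(** * Cliques through the centre of the star of monochromatic edges *)

Section Star.
Variables (u : V) (j : 'I_p).
Hypothesis j_neq : j != c u.
Let D1 := nb G u :&: part c (c u).
Let Dj := nb G u :&: part c j.
Let middle : {set 'I_p} := ~: [set c u; j].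
Let common x z i := part c i :&: nb G u :&: nb G x :&: nb G z.

Let cmiddle : #|middle| = p - 2.
Proof.
have := cardsC [set c u; j]; rewrite cards2 eq_sym j_neq card_ord => e.
by apply/eqP; rewrite -(eqn_add2l 2) subnKC // e.
Qed.

Let in_part x (i : 'I_p) : x \in part c i -> c x = i.
Proof. by rewrite inE => /eqP e; apply: val_inj. Qed.

(** An adjacent pair [x], [z] forms a [K_{p+1}] with [u] and any clique counted by [T]. None arises
    twice, as [D1], [Dj] and the middle classes are disjoint. *)
Lemma star_count T :
  (forall x z, x \in D1 -> z \in Dj -> G x z ->
     T <= clq G (p - 2) (\bigcup_(i <- enum middle) common x z i)) ->
  (\sum_(x in D1) #|Dj :&: nb G x|) * T <= N.
Proof.
move=> hT; have pE : (p - 2).+2 = p by lia.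
apply: leq_trans (clq_nb _ _ u); rewrite -[X in _ <= clq _ X _]pE.
have -> : nb G u = D1 :|: (nb G u :\: D1).
  by rewrite setDE setUIr setUCr setIT; apply/esym/setUidPr/subsetIl.
apply: leq_trans (@sum_clq_disjoint _ G _ (nb G u :\: D1) D1 _); last by rewrite disjoints_subset setCD subsetUr.
rewrite big_distrl /=; apply: leq_sum => x xD1.
set C := (nb G u :\: D1) :&: nb G x.
have sC : (Dj :&: nb G x) :|: (C :\: (Dj :&: nb G x)) \subset C.
  rewrite subUset subsetDl andbT; apply/subsetP => z /setIP[/setIP[gz zj] gxz].
  by rewrite in_setI gxz in_setD gz !andbT in_setI gz inE (in_part zj) val_eqE.
apply: leq_trans (clq_sub _ _ sC).
apply: leq_trans (@sum_clq_disjoint _ G _ (C :\: (Dj :&: nb G x)) (Dj :&: nb G x) _); last by rewrite disjoints_subset setCD subsetUr.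
rewrite -sum_nat_const; apply: leq_sum => z; rewrite inE => /andP[zDj]; rewrite inE => gxz.
apply: (leq_trans (hT x z xD1 zDj gxz)); apply: clq_sub; rewrite bigcup_seq.
apply/bigcupsP => i; rewrite mem_enum !inE negb_or => /andP[ni nj].
apply/subsetP => t; rewrite /common inE => /andP[/setIP[/setIP[ti gut] gxt] gzt].
move: gut gxt gzt; rewrite !inE => -> -> ->; rewrite (in_part ti) ?andbT.
by rewrite !val_eqE (negbTE ni) (negbTE nj).
Qed.

(** Three copies of [y] pay for the non-neighbours of [u], [x] and [z], the other [p - 2] for the
    greedy choice. *)
Lemma star_middle y x z :
  (forall t i, i \in middle -> c t != i -> #|part c i :\: nb G t| <= y) ->
  c x = c u -> c z = j ->
  \prod_(i in middle) (#|part c i| - (3 + (p - 2)) * y) <=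
  clq G (p - 2) (\bigcup_(i <- enum middle) common x z i).
Proof.
move=> hy cx cz.
have sub i : common x z i \subset part c i by rewrite /common -!setIA subsetIl.
rewrite -{2}cmiddle cardE.
apply: leq_trans (@greedy_transversal _ G _ c _ (common x z) y (enum_uniq _) _ _).
- rewrite big_enum /= -cardE cmiddle; apply: leq_prod => i im.
  have [ni nj] : c u != i /\ j != i.
    by move: im; rewrite !inE negb_or ![_ == i]eq_sym => /andP[].
  have cut t (A : {set V}) : c t != i -> A \subset part c i -> #|A| <= #|A :&: nb G t| + y.
    move=> ct sA; rewrite -(cardsID (nb G t) A) leq_add2l (leq_trans _ (hy t i im ct)) //.
    by rewrite subset_leq_card // setSD.
  have := cut u (part c i) ni (subxx _).
  have := cut x (part c i :&: nb G u); rewrite cx subsetIl => /(_ ni isT).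
  have := cut z (part c i :&: nb G u :&: nb G x); rewrite cz -setIA subsetIl => /(_ nj isT).
  by rewrite /common !setIA mulnDl; clear; lia.
- by move=> i t _ /(subsetP (sub i)); apply: in_part.
move=> i k t; rewrite !mem_enum => im km nik /(subsetP (sub i)) /in_part ct.
rewrite (leq_trans _ (hy t k km _)) ?ct //.
by apply/subset_leq_card/setSD.
Qed.

Hypothesis (inner_star : inner2 G c = 2 * inner_deg G c u).
Variable v : V.
Hypotheses (guv : G u v) (cuv : c u = c v).
Hypothesis gap : f <= #|part c j :\: nb G u| + #|part c j :\: nb G v| + 4 * w.

Let k := #|D1|.
Let q := #|Dj|.
Let M := \sum_(x in D1) #|part c j :\: nb G x|.
Let P := \sum_(x in D1) #|Dj :&: nb G x|.

Let inner_degD1 : inner_deg G c u = k.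
Proof. by apply: eq_card => y; rewrite !inE val_eqE. Qed.

Let vD1 : v \in D1.
Proof. by rewrite !inE guv cuv eqxx. Qed.

Let k0 : 0 < k.
Proof. by apply/card_gt0P; exists v. Qed.

Let kq : k <= q.
Proof. by rewrite -inner_degD1; apply: min_inner_deg. Qed.

Let PM : k * q <= P + M.
Proof.
rewrite -sum_nat_const -big_split; apply: leq_sum => x _ /=.
rewrite /q -(cardsID (nb G x) Dj) leq_add2l subset_leq_card // setSD //.
exact: subsetIr.
Qed.

Let partDj : #|part c j :\: nb G u| + q = #|part c j|.
Proof. by rewrite addnC /q /Dj setIC cardsID. Qed.

Let uD1 : u \notin D1.
Proof. by rewrite !inE adj_irr. Qed.

Let colour_uD1 : {in u |: D1, forall x, c x = c u}.
Proof. by move=> x; rewrite !inE => /orP[/eqP->//|/andP[_ /eqP e]]; apply: val_inj. Qed.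

Let missing_lower0 : 2 * (#|part c j :\: nb G u| + M) <= missing2 G c.
Proof. by have := sum_missing_parts G colour_uD1 j_neq; rewrite big_setU1. Qed.

Let missing_lower x0 i : i \in middle -> c x0 != i ->
  2 * (#|part c j :\: nb G u| + M + #|part c i :\: nb G x0|) <= missing2 G c.
Proof.
rewrite !inE negb_or => /andP[ni nj] nx0.
by have := sum_missing_parts_extra G colour_uD1 j_neq ni nj nx0; rewrite big_setU1.
Qed.

Let balance :
  missing2 G c + \sum_(i < p) defect f #|part c i| + 2 * s.+1 <= 2 * k + 2 * f.
Proof. by have := edge_balance; rewrite inner_star inner_degD1. Qed.

(** By [gap], class [j] already accounts for [f - 4 * w] missing pairs, out of at most [f + k] with
    [k <= 12 * w]; at most [16 * w] remain for a middle class. *)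
Lemma middle_missing t i : i \in middle -> c t != i -> #|part c i :\: nb G t| <= 16 * w.
Proof.
move=> im ct; have := missing_lower im ct.
have : #|part c j :\: nb G v| <= M by rewrite /M (bigD1 v) //= leq_addr.
have := inner2_bound; rewrite inner_star inner_degD1.
by move: gap balance; clear; lia.
Qed.

Hypothesis f_large : s * f.+1 ^ (p - 2) <= s.+1 * (f - (49 + 16 * p) * w) ^ (p - 2).

(** One adjacent pair beyond [s] outweighs all error terms of order [w] in the middle classes; this
    is what [f_large] expresses. *)
Lemma many_pairs : s < P -> s * f.+1 ^ (p - 2) <= N.
Proof.
move=> sP; apply: (leq_trans f_large).
apply: leq_trans (@star_count ((f - (49 + 16 * p) * w) ^ (p - 2)) _).
  by rewrite leq_mul2r sP orbT.
move=> x z; rewrite inE => /andP[_ /in_part cx]; rewrite inE => /andP[_ /in_part cz] _.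
apply: leq_trans (star_middle middle_missing cx cz).
rewrite -{1}cmiddle -prod_nat_const; apply: leq_prod => i _.
have -> : 3 + (p - 2) = p.+1 by move: p2; clear; lia.
by have := part_lower i; clear; lia.
Qed.

(** At least [k q - P] pairs between [D1] and [Dj] are missing, and [k q >= k + q - 1]. Inserted in
    [balance], this leaves no slack when [P <= s]: then [P = s], all classes but [j] have zero
    defect, and nothing is missing towards the middle classes. *)
Lemma few_pairs h : P <= s -> h <= (n %% p).-1 -> h <= p - 2 ->
  s * balprod f (p - 2) h <= N.
Proof.
move=> Ps h1 h2.
(* This is [(k - 1) (q - 1) >= 0]. *)
have kq1 : k + q <= k * q + 1.
  by move: k0 kq; case: (k) => // k'; case: (q) => // q' _ _; clear; lia.
have defj := defect_lower f #|part c j|.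
have balance_j := balance; rewrite (bigD1 j) //= in balance_j.
have tight : #|part c j| <= f /\ forall i, i != j -> defect f #|part c i| = 0.
  split=> [|i nij].
    by move: balance_j missing_lower0 PM kq1 partDj Ps; clear; lia.
  have := balance_j; rewrite (bigD1 i) //=.
  by move: defj missing_lower0 PM kq1 partDj Ps; clear; lia.
have [jf def0] := tight.
have sP : s <= P.
  by move: balance_j defj missing_lower0 PM kq1 partDj; clear; lia.
have complete t i : i \in middle -> c t != i -> #|part c i :\: nb G t| <= 0.
  move=> im ct; have := missing_lower im ct.
  by move: balance_j defj PM kq1 partDj Ps; clear; lia.
apply: leq_trans (@star_count (\prod_(i in middle) #|part c i|) _); last first.
  move=> x z; rewrite inE => /andP[_ /in_part cx]; rewrite inE => /andP[_ /in_part cz] _.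
  apply: leq_trans (star_middle complete cx cz).
  by rewrite leq_prod // => i _; rewrite muln0 subn0.
apply: leq_mul => //.
have [|eprod /andP[_ hsum]] := @prod_balanced _ middle (fun i => #|part c i|) f.
  by move=> i; rewrite !inE negb_or => /andP[_ nj]; apply: def0.
(* The class of [u] and class [j] hold at most [2 f + 1] vertices together, so at least
   [(n %% p).-1] middle classes have size [f.+1]. *)
rewrite eprod cmiddle; rewrite cmiddle in hsum; apply: balprod_leq.
have : \sum_(i in middle) #|part c i| + #|part c (c u)| + #|part c j| = n.
  have := sum_card_part c; rewrite (bigD1 (c u)) //= (bigD1 j) //=.
  rewrite (eq_bigl [in middle]) => [<-|i]; last by rewrite !inE negb_or.
  by rewrite -addnA addnC -addnA.
have cuf : #|part c (c u)| <= f.+1.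
  by have /defect_eq0[->|->] : defect f #|part c (c u)| = 0 by apply: def0; rewrite eq_sym.
have e2 : p * f = (p - 2) * f + f + f.
  by rewrite -{1}(subnK p2) mulnDl mul2n -addnn addnA.
have := divn_eq n p; rewrite -fE mulnC e2; move: cuf jf hsum h1 h2; clear; lia.
Qed.

End Star.

Lemma clique_count_lower h : ~ partite p G ->
  s * f.+1 ^ (p - 2) <= s.+1 * (f - (49 + 16 * p) * w) ^ (p - 2) ->
  h <= (n %% p).-1 -> h <= p - 2 -> s * balprod f (p - 2) h <= N.
Proof.
move=> npart flarge h1 h2; have [u [[v guv cuv] star]] := star_center npart.
have [j nj gap] := inner_edge_gap guv cuv.
have [le|lt] := leqP (\sum_(x in nb G u :&: part c (c u)) #|(nb G u :&: part c j) :&: nb G x|) s.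
  exact: (few_pairs nj star guv cuv le).
apply: leq_trans (many_pairs nj star guv cuv gap flarge lt).
by rewrite leq_mul2l balprod_max ?orbT.
Qed.

End Finish.

(** * Large n *)

(** Bernoulli's inequality [1 - m/d <= (1 - 1/d) ^ m], multiplied by [d ^ m.+1]. *)
Lemma bernoulli d m : (d - m) * d ^ m <= d * d.-1 ^ m.
Proof.
elim: m => [|m IH]; first by rewrite subn0.
have step : (d - m.+1) * d <= d.-1 * (d - m).
  have [le|lt] := leqP d m; first by rewrite (eqP (_ : d - m.+1 == 0)) // subn_eq0 ltnW.
  have [e ->] : exists e, d = m.+1 + e by exists (d - m.+1); lia.
  by rewrite addKn addSn -pred_Sn -addnS addKn; lia.
rewrite !expnS mulnA (leq_trans (leq_mul step (leqnn _))) // -mulnA.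
by rewrite [d * (_ * _)]mulnCA leq_mul2l IH orbT.
Qed.

(** [f - x] is at least the fraction [1 - 1/d] of [f.+1], so by Bernoulli its power keeps at least
    [1 - m/d >= s / (s + 1)]. *)
Lemma power_ratio s m d f x : m * s.+1 < d -> d * x.+1 <= f.+1 ->
  s * f.+1 ^ m <= s.+1 * (f - x) ^ m.
Proof.
move=> hd hx; have d0 : 0 < d by lia.
rewrite -(@leq_pmul2l (d ^ m.+1)) ?expn_gt0 ?d0 //.
have h1 : (d.-1 * f.+1) ^ m <= (d * (f - x)) ^ m.
  case: m hd => [//|m _]; rewrite leq_exp2r //.
  have -> : f - x = f.+1 - x.+1 by lia.
  by rewrite mulnBr -subn1 mulnBl mul1n leq_sub2l.
have h2 : s * d <= s.+1 * (d - m).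
  by rewrite mulnBr mulSn; move: hd; rewrite [m * _]mulnC; lia.
apply: (@leq_trans (s.+1 * (d - m) * d ^ m * f.+1 ^ m)).
  rewrite expnS mulnA leq_mul2r; apply/orP; right.
  by rewrite mulnAC leq_mul2r mulnC h2 orbT.
rewrite -[s.+1 * _ * _]mulnA (leq_trans (leq_mul (leq_mul (leqnn _) (bernoulli d m)) (leqnn _))) //.
rewrite -!mulnA -expnMn (leq_trans (leq_mul (leqnn _) (leq_mul (leqnn _) h1))) //.
by rewrite expnMn expnS; lia.
Qed.

Section Asymptotics.
Variables (p s : nat).
Hypothesis (p2 : 2 <= p).

Definition ratio_bound := (p - 2) * s.+1 + 1.
(** With unit [b = n %/ scale], the first summand yields [unit_small], the second [ratio_large]. *)
Definition scale := 200 * p ^ 2 + p * ratio_bound * ((49 + 16 * p) * p + 1).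
(** The first term gives [2 * f <= b ^ 2]; the second makes [w ^ p.-1] at least the clique count of
    [Y]. *)
Definition min_unit := 4 * scale + s * (2 * scale) ^ (p - 2) + 1.

Lemma scale_gt0 : 0 < scale.
Proof. by rewrite addn_gt0 muln_gt0 expn_gt0 (ltnW p2). Qed.

Section Unit.
Variable n : nat.
Hypothesis n_large : scale * min_unit <= n.
Let b := n %/ scale.
Let f := n %/ p.

Lemma unit_large : min_unit <= b.
Proof. by rewrite leq_divRL ?scale_gt0 // mulnC. Qed.

Lemma unit_gt0 : 0 < b.
Proof. by apply: leq_trans unit_large; rewrite /min_unit addn1. Qed.

Lemma n_unit : n <= 2 * scale * b.
Proof.
have := ltn_ceil n scale_gt0; have := unit_gt0; rewrite -/b.
move: scale_gt0; move: scale b => Q x Q0 x0.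
by rewrite mulSn; have := leq_pmulr Q x0; lia.
Qed.

Lemma unit_small : 200 * (p * b) <= f.
Proof.
rewrite leq_divRL ?(ltnW p2) //; apply: leq_trans (leq_divM n scale).
by rewrite -/b /scale -mulnn mulnDr; lia.
Qed.

Lemma inner_bound I : 4 * scale ^ 2 * I <= n ^ 2 -> I + 2 * f <= p * b * b.
Proof.
move=> h; have hI : I <= b ^ 2.
  have Q0 := scale_gt0.
  rewrite -(@leq_pmul2l (4 * scale ^ 2)) ?muln_gt0 ?expn_gt0 ?Q0 //.
  apply: (leq_trans h); have -> : 4 * scale ^ 2 * b ^ 2 = (2 * scale * b) ^ 2 by rewrite !expnMn.
  by rewrite leq_sqr n_unit.
have hf : 2 * f <= b ^ 2.
  apply: (@leq_trans (2 * n)); first by rewrite leq_mul2l leq_div orbT.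
  apply: (@leq_trans (4 * scale * b)); first by have := n_unit; lia.
  rewrite -mulnn leq_mul2r (leq_trans _ unit_large) ?orbT //.
  by rewrite /min_unit -addnA leq_addr.
apply: (leq_trans (leq_add hI hf)); rewrite addnn -mul2n -mulnn mulnA leq_mul2r leq_mul2r p2.
by rewrite !orbT.
Qed.

Lemma target_small h : h <= p - 2 -> s * balprod f (p - 2) h <= s * n ^ (p - 2).
Proof.
move=> hp; rewrite leq_mul2l (leq_trans (balprod_max _ hp)) ?orbT //.
case: (p - 2) => [//|m]; rewrite leq_exp2r // ltn_Pdiv //.
by have := unit_gt0; rewrite divn_gt0 ?scale_gt0 //; apply: leq_trans scale_gt0.
Qed.

Lemma target_small_unit h : h <= p - 2 -> s * balprod f (p - 2) h <= (p * b) ^ p.-1.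
Proof.
move=> hp; apply: (leq_trans (target_small hp)).
apply: (@leq_trans (s * (2 * scale * b) ^ (p - 2))).
  by rewrite leq_mul2l; case: (p - 2) => [|m]; rewrite ?orbT // leq_exp2r // n_unit orbT.
rewrite expnMn mulnA; have -> : p.-1 = (p - 2).+1 by lia.
rewrite expnS leq_mul //.
  apply: (@leq_trans b); last by rewrite leq_pmull // ltnW.
  by apply: leq_trans unit_large; rewrite /min_unit addnAC leq_addl.
by case: (p - 2) => [|m] //; rewrite leq_exp2r // leq_pmull // ltnW.
Qed.

Lemma ratio_large :
  s * f.+1 ^ (p - 2) <= s.+1 * (f - (49 + 16 * p) * (p * b)) ^ (p - 2).
Proof.
apply: (@power_ratio _ _ ratio_bound); first by rewrite /ratio_bound addn1.
apply: leqW; rewrite leq_divRL ?(ltnW p2) //; apply: leq_trans (leq_divM n scale).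
rewrite -/b /scale mulnDr -addn1.
apply: (@leq_trans (ratio_bound * (((49 + 16 * p) * p + 1) * b) * p)).
  have -> : ((49 + 16 * p) * p + 1) * b = (49 + 16 * p) * (p * b) + b by clear; lia.
  by rewrite leq_mul2r leq_mul2l leq_add2l unit_gt0 !orbT.
by clear; lia.
Qed.

(** Puts the edge condition in the form that [stability] takes; [E] stands for twice the edge count,
    and [p ^ 2 <= n] absorbs the rounding in [f]. *)
Lemma few_nonedges E : p ^ 2 <= n ->
  n ^ 2 + p * (f * f.+1) + 2 * s.+1 <= E + 2 * f + f.*2.+1 * n ->
  p * (n ^ 2 - E) <= n ^ 2 + 3 * n.
Proof.
move=> np hE.
have [r rp nE] : exists2 r, r < p & n = p * f + r.
  by exists (n %% p); [rewrite ltn_mod ltnW | rewrite mulnC -divn_eq].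
have h0 : n ^ 2 - E <= 2 * f + f.*2.+1 * n - p * (f * f.+1) by lia.
apply: (leq_trans (leq_mul (leqnn p) h0)).
have rp2 : r * p <= p ^ 2 by rewrite -mulnn leq_mul2r ltnW ?orbT.
have h1 : p * (2 * f + f.*2.+1 * n) <= p * (p * (f * f.+1)) + n ^ 2 + r * p + 2 * n.
  by rewrite -muln2 nE -!mulnn; clear; lia.
by rewrite mulnBr leq_subLR (leq_trans h1) //; move: rp2 np; clear; lia.
Qed.

End Unit.
End Asymptotics.

(** * Combination of stability with a minimal colouring *)

Lemma inner2_min (V : finType) (G : sgraph V) p (c0 : V -> 'I_p) :
  exists2 c : V -> 'I_p, inner2 G c <= inner2 G c0 & forall c' : V -> 'I_p, inner2 G c <= inner2 G c'.
Proof.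
have ext (c c' : V -> 'I_p) : c =1 c' -> inner2 G c = inner2 G c'.
  by move=> e; apply: eq_bigr => x _; apply: eq_card => y; rewrite !inE !e.
have ffE (c : V -> 'I_p) : inner2 G c = inner2 G (finfun c) by apply: ext => x; rewrite ffunE.
case: (@arg_minnP _ (finfun c0) predT (fun c : {ffun V -> 'I_p} => inner2 G c) isT) => c _ hc.
by exists c => [|c']; rewrite [X in _ <= X]ffE; apply: hc.
Qed.

Lemma nonedges2_setT (V : finType) (G : sgraph V) :
  nonedges2 G setT = #|V| ^ 2 - (num_edges G).*2.
Proof.
have : nonedges2 G setT + (num_edges G).*2 = #|V| ^ 2.
  rewrite num_edges2 /nonedges2 (eq_bigl predT) => [|x]; last by rewrite inE.
  rewrite -big_split /= (eq_bigr (fun=> #|V|)) ?sum_nat_const ?mulnn // => x _.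
  by rewrite setTD addnC cardsC.
by move <-; rewrite addnK.
Qed.

Theorem theorem1p3 (p s : nat) (hp : 2 <= p) (hs : 1 <= s) :
  exists n0 : nat, forall n : nat, n0 <= n ->
    (exists Y : sgraph 'I_n, is_Y n p s Y) /\
    forall (W : finType) (Y : sgraph W), is_Y n p s Y ->
      (forall (V : finType) (G : sgraph V),
         #|V| = n -> ~ partite p G -> num_edges Y <= num_edges G ->
         num_cliques p.+1 Y <= num_cliques p.+1 G) /\
      [/\ #|W| = n, ~ partite p Y, num_edges Y <= num_edges Y
         & num_cliques p.+1 Y = num_cliques p.+1 Y].
Proof.
have p0 : 0 < p by exact: ltnW.
(* This precision makes [inner2] at most [b ^ 2] for the unit [b]. *)
have K0 : 0 < 4 * scale p s ^ 2 by rewrite muln_gt0 expn_gt0 scale_gt0.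
have [n1 stab] := stability s hp K0.
exists (n1 + scale p s * min_unit p s + p * s + 2 * p + p ^ 2) => n n0n.
have [nn1 nlarge nps n2p npp] : [/\ n1 <= n, scale p s * min_unit p s <= n, p * s <= n, 2 * p <= n & p ^ 2 <= n].
  by split; move: n0n; move: (scale p s * _); clear; lia.
split; first by apply: Y_exists => //; rewrite leq_divRL // mulnC.
move=> W Y [[_ _ _ sf cW] [c [u [v [X1 [turan_c sorted_c [hu hv uv] [sX1 cX1] YE]]]]]].
subst n.
split; last first.
  by split=> //; apply: clq_gt0_nonpartite; apply: (Y_has_clique hp hs sf turan_c sorted_c hu hv uv sX1 cX1 YE).
move=> V G cV npart eYG.
have YE2 := Y_num_edges hp hs sf turan_c sorted_c hu hv uv sX1 cX1 YE.
have [h [h1 h2] YN] := Y_num_cliques hp hs sf turan_c sorted_c hu hv uv sX1 cX1 YE.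
apply: (leq_trans YN); rewrite num_cliquesE.
have GE : #|V| ^ 2 + p * ((#|V| %/ p) * (#|V| %/ p).+1) + 2 * s.+1 <=
   (num_edges G).*2 + 2 * (#|V| %/ p) + (#|V| %/ p).*2.+1 * #|V|.
  by rewrite cV (leq_trans YE2) // !leq_add2r leq_double.
rewrite -cV in nn1 nlarge npp h1 *; clear cV YE2 YN.
(* The assumption [few] serves twice: it gives the [n ^ (p - 2)] bound for [stability] and the bound
   [w ^ p.-1] for the structural part. *)
rewrite leqNgt; apply/negP => few.
have [||c0 hc0] := stab V G nn1.
- by rewrite nonedges2_setT; apply: few_nonedges GE.
- apply: (@leq_trans (s * #|V| ^ (p - 2) * #|V| ^ 2)).
    by rewrite leq_mul2r (leq_trans (ltnW few)) ?orbT // target_small.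
  by rewrite -mulnA -expnD subnK.
have [c1 c10 min1] := inner2_min G c0.
have hI : 4 * scale p s ^ 2 * inner2 G c1 <= #|V| ^ 2.
  by rewrite (leq_trans _ hc0) // leq_mul2l c10 orbT.
move: (few); rewrite ltnNge => /negP[].
apply: (clique_count_lower (erefl _) hp (unit_gt0 hp nlarge) (unit_small hp nlarge)
  (inner_bound hp nlarge hI) min1 GE _ npart (ratio_large hp nlarge) h1 h2).
exact: leq_trans few (target_small_unit hp nlarge h2).
Qed.
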